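(* Let $G=(V,E)$ with free arcs $E^{\infty}\subseteq E$ be a generalized network. Let $\lambda\in\mathbb{R}^V$ be the thin flow direction of the configuration $(E,E^\infty)$, and let $l^\circ\in\Omega$ be any feasible labeling. Then there is a value $T$ such that for any equilibrium trajectory $\ell$ starting from $l^\circ$, $\ell'_v(\theta)=\lambda_v$ for all $v\in V$ and all $\theta\ge T$.
   Context: **Network.** A network is a finite directed graph $G=(V,E)$ with a source $s$ and a sink $t\neq s$, transit times $\tau_e\ge 0$ and capacities $\nu_e>0$ for $e\in E$, and a constant inflow rate $u_0>0$. Standing assumptions: every node is reachable from $s$ and can reach $t$ in $G$; $G$ has no directed cycle all of whose arcs have transit time $0$. An arc from $v$ to $w$ is written $e=vw$. **Valid configuration.** A pair $(E',E^* )$ with $E^*\subseteq E'\subseteq E$ is a valid configuration if (i) for every $v\in V$ there is an $s$-$v$-path in $E'$; (ii) every arc of $E^*$ lies on an $s$-$t$-path in $E'$; (iii) no arc of $E^*$ lies on a directed cycle in $(V,E')$. **Thin flows.** For a valid configuration $(E',E^* )$, a thin flow solution is a pair $(\ell',x')$ with $\ell'\in\mathbb{R}^V$ and $x'\in\mathbb{R}_{\ge0}^{E}$ such that: $x'$ is a static $s$-$t$-flow of value $u_0$ supported on $E'$; $\ell'_s=1$; $\ell'_w\le\rho_e(\ell'_v,x'_e)$ for all $e=vw\in E'$; $\ell'_w=\rho_e(\ell'_v,x'_e)$ for all $e=vw\in E'$ with $x'_e>0$. Here $\rho_e(\ell'_v,x'_e)=x'_e/\nu_e$ if $e\in E^*$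 and $\rho_e(\ell'_v,x'_e)=\max\{\ell'_v,x'_e/\nu_e\}$ if $e\in E'\setminus E^*$. A solution is maximal if $\ell'$ is pointwise maximal among solutions (no solution $(h',y')$ has $h'\ge\ell'$, $h'\ne\ell'$). For every valid configuration a maximal solution exists and its $\ell'$ is unique; this $\ell'$ is called the thin flow direction of the configuration. **Generalized network.** A network $G=(V,E)$ together with a set $E^{\infty}\subseteq E$ of free arcs such that $(E,E^{\infty})$ is a valid configuration. For $l\in\mathbb{R}^V$ put $E'_l=E^\infty\cup\{e=vw\in E: l_w-l_v\ge\tau_e\}$ and $E^*_l=E^\infty\cup\{e=vw\in E: l_w-l_v>\tau_e\}$. The vector $l$ is a feasible labeling if $(E'_l,E^*_l)$ is a valid configuration; $\Omega\subseteq\mathbb{R}^V$ is the set of feasible labelings. For $l\in\Omega$, $X(l)\in\mathbb{R}^V$ denotes the thin flow direction of $(E'_l,E^*_l)$. **Equilibrium trajectory.** A locally absolutely continuous function $\ell:[0,\infty)\to\mathbb{R}^V$ such that $\ell(\theta)\in\Omega$ for all $\theta\ge0$ and $\ell'(\theta)=X(\ell(\theta))$ for almost every $\theta\ge 0$. Its starting point is $\ell(0)$. *)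

(* Defs.v *)
From HB Require Import structures.
From mathcomp Require Import all_boot all_order all_algebra.
From mathcomp Require Import all_classical all_reals all_analysis.
Import Order.TTheory GRing.Theory Num.Theory.
Import numFieldNormedType.Exports.

Set Implicit Arguments.
Unset Strict Implicit.
Unset Printing Implicit Defensive.

Local Open Scope ring_scope.

Section Digraph.

(* Parallel arcs and loops are allowed.  A walk is given by its starting vertex
   and its sequence of arcs. *)
Variables (V E : finType) (src tgt : E -> V).

Fixpoint diwalk (v : V) (p : seq E) (w : V) : bool :=
  if p is e :: p' then (src e == v) && diwalk (tgt e) p' w else v == w.

Definition dipath (A : {set E}) (v : V) (p : seq E) (w : V) : bool :=
  [&& all (mem A) p, diwalk v p w & uniq (v :: map tgt p)].

Definition dicycle (A : {set E}) (p : seq E) : Prop :=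
  p <> [::] /\
  exists v : V, [&& all (mem A) p, diwalk v p v & uniq (map tgt p)].

End Digraph.

Record network (R : realType) := Network {
  vertex : finType;
  edge : finType;
  edge_tail : edge -> vertex;
  edge_head : edge -> vertex;
  source : vertex;
  sink : vertex;
  transit : edge -> R;
  capacity : edge -> R;
  inflow : R;
  sink_neq_source : sink <> source;
  transit_ge0 : forall e, 0 <= transit e;
  capacity_gt0 : forall e, 0 < capacity e;
  inflow_gt0 : 0 < inflow;
  reachable_from_source :
    forall v, exists p, dipath edge_tail edge_head [set: edge] source p v;
  sink_reachable :
    forall v, exists p, dipath edge_tail edge_head [set: edge] v p sink;
  no_zero_transit_cycle :
    forall p, dicycle edge_tail edge_head [set: edge] p ->
      ~ (forall e, e \in p -> transit e = 0)
}.

Section ThinFlow.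

Variables (R : realType) (N : network R).

Local Notation V := (vertex N).
Local Notation E := (edge N).
Local Notation path_in := (dipath (@edge_tail R N) (@edge_head R N)).
Local Notation cycle_in := (dicycle (@edge_tail R N) (@edge_head R N)).

Definition valid_configuration (E1 Es : {set E}) : Prop :=
  [/\ Es \subset E1,
      forall v : V, exists p, path_in E1 (source N) p v,
      forall e, e \in Es ->
        exists2 p, path_in E1 (source N) p (sink N) & e \in p
    & forall e, e \in Es -> ~ exists2 p, cycle_in E1 p & e \in p].

Definition net_outflow (x : E -> R) (v : V) : R :=
  \sum_(e : E | edge_tail e == v) x e - \sum_(e : E | edge_head e == v) x e.

Definition static_flow (val : R) (x : E -> R) : Prop :=
  [/\ forall e, 0 <= x e,
      forall v : V, v <> source N -> v <> sink N -> net_outflow x v = 0,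
      net_outflow x (source N) = val
    & net_outflow x (sink N) = - val].

Definition rho (Es : {set E}) (e : E) (a y : R) : R :=
  if e \in Es then y / capacity e else Num.max a (y / capacity e).

Definition thin_flow_solution (E1 Es : {set E}) (l' : V -> R) (x' : E -> R) :
  Prop :=
  [/\ static_flow (inflow N) x',
      forall e, e \notin E1 -> x' e = 0,
      l' (source N) = 1,
      forall e, e \in E1 ->
        l' (edge_head e) <= rho Es e (l' (edge_tail e)) (x' e)
    & forall e, e \in E1 -> 0 < x' e ->
        l' (edge_head e) = rho Es e (l' (edge_tail e)) (x' e)].

Definition maximal_thin_flow_solution (E1 Es : {set E})
    (l' : V -> R) (x' : E -> R) : Prop :=
  thin_flow_solution E1 Es l' x' /\
  ~ (exists h' y', [/\ thin_flow_solution E1 Es h' y',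
                       forall v, l' v <= h' v & h' <> l']).

(* The thin flow direction is given by its graph, so that its existence and
   uniqueness for valid configurations are not built into the definition. *)
Definition is_thin_flow_direction (E1 Es : {set E}) (l' : V -> R) : Prop :=
  exists x', maximal_thin_flow_solution E1 Es l' x'.

End ThinFlow.

Record generalized_network (R : realType) := GeneralizedNetwork {
  gnetwork :> network R;
  free_arcs : {set edge gnetwork};
  free_arcs_valid : valid_configuration [set: edge gnetwork] free_arcs
}.

Section AbsoluteContinuity.

Variable R : realType.

Definition absolutely_continuous (a b : R) (f : R -> R) : Prop :=
  forall eps : R, 0 < eps -> exists2 delta : R, 0 < delta &
    forall I : seq (R * R),
      (forall i, i \in I -> [/\ a <= i.1, i.1 < i.2 & i.2 <= b]) ->
      pairwise (fun i j : R * R => (i.2 <= j.1) || (j.2 <= i.1)) I ->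
      \sum_(i <- I) (i.2 - i.1) < delta ->
      \sum_(i <- I) `|f i.2 - f i.1| < eps.

Definition locally_absolutely_continuous (f : R -> R) : Prop :=
  forall a b : R, 0 <= a -> a <= b -> absolutely_continuous a b f.

End AbsoluteContinuity.

Section Trajectory.

Variables (R : realType) (G : generalized_network R).

Local Notation V := (vertex G).
Local Notation E := (edge G).

Definition active_arcs (l : V -> R) : {set E} :=
  free_arcs G :|: [set e : E | transit e <= l (edge_head e) - l (edge_tail e)].

Definition queueing_arcs (l : V -> R) : {set E} :=
  free_arcs G :|: [set e : E | transit e < l (edge_head e) - l (edge_tail e)].

Definition feasible_labeling (l : V -> R) : Prop :=
  valid_configuration (active_arcs l) (queueing_arcs l).

Definition is_direction_at (l l' : V -> R) : Prop :=
  is_thin_flow_direction (active_arcs l) (queueing_arcs l) l'.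

(* Trajectories are total functions of time, but only their restriction to
   [0, +oo) is constrained: the two-sided derivative at time 0, which depends on
   values at negative times, is irrelevant almost everywhere. *)
Definition equilibrium_trajectory (l : R -> V -> R) : Prop :=
  [/\ forall v, locally_absolutely_continuous (fun theta => l theta v),
      forall theta : R, 0 <= theta -> feasible_labeling (l theta)
    & {ae (@lebesgue_measure R), forall theta : R, 0 <= theta ->
        exists2 l' : V -> R,
          forall v, is_derive theta (1 : R) (fun xi => l xi v) (l' v)
        & is_direction_at (l theta) l'}].

End Trajectory.

(* Main.v *)
(* Write m_v = l_v / lambda_v, q_e = l_w - l_v - tau_e for e = vw, and
   r_v = l'_v / lambda_v for a direction l'.  The concave potential
     Phi(l) = u_0 (m_t - m_s) - sum_(e free) nu_e lambda_w (m_w - m_v)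
              - sum_(e not free) nu_e (q_e^+ - max(0, lambda_w / lambda_v - 1) l_v)
   is bounded above: for every thin flow y of (E, E^oo) with labels lambda,
   Phi(l) is a constant minus a sum of nonnegative complementary slackness gaps
   between y and l.  Along a trajectory with thin flow x, subtracting the flow
   identity sum_e x_e (ln r_w - ln r_v) = u_0 (ln r_t - ln r_s) writes Phi' as a
   sum of nonnegative relative entropies.  Since there are finitely many
   configurations, each with a unique direction, Phi' vanishes within bounded
   time; at such a moment x is itself a thin flow for lambda that is complementary
   to l, so Phi is at its maximum and stays there.

   From then on l' >= lambda, with equality on the nodes carrying x.  The other
   nodes are tied to those by arcs along which lambda is constant and no queue
   forms, so l - lambda theta is nondecreasing and bounded, and l' = lambda occurs
   within bounded time.  At that moment these arcs can be chosen tight (otherwise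
   lambda would not be maximal), and tight arcs forbid any later increase. *)
Require Import Defs.
From mathcomp Require Import all_boot all_order all_algebra.
From mathcomp Require Import all_classical all_reals all_analysis.
From mathcomp Require Import ring lra.
Import Order.TTheory GRing.Theory Num.Theory.
Import numFieldNormedType.Exports.

Set Implicit Arguments.
Unset Strict Implicit.
Unset Printing Implicit Defensive.

Local Open Scope ring_scope.

(** * Right derivatives and absolutely continuous functions *)

Section FiniteMinima.

Variables (R : realType) (I : finType).

Lemma finite_lower_bound (d : I -> R) :
  (forall i, 0 < d i) -> exists2 e, 0 < e & forall i, e <= d i.
Proof.
move=> d0; exists (\big[Order.min/1]_i d i) => [|i]; last exact: bigmin_le.
by apply: lt_bigmin => // i _; exact: d0.
Qed.

(** Finiteness gives uniformity: this bounds from below the amounts by which labels can be raised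
    and, over all configurations, the positive rates of growth. *)
Lemma finite_positive_gap (f : I -> R) :
  exists2 e, 0 < e & forall i, 0 < f i -> e <= f i.
Proof.
have [i|e e0 ef] := @finite_lower_bound (fun i => if 0 < f i then f i else 1).
  by case: ifP.
by exists e => // i fi; have := ef i; rewrite fi.
Qed.

End FiniteMinima.

Section RightDerivative.

Variable R : realType.
Implicit Types (f g q : R -> R) (x a b c D : R).

(** One-sided, because the positive part of an excess has only one-sided derivatives where a queue
    starts to form; free of quotients, so that linear arithmetic applies. *)
Definition right_derivative f x D :=
  forall e, 0 < e -> exists2 d, 0 < d &
    forall h, 0 < h -> h < d -> `|f (x + h) - f x - D * h| <= e * h.

Lemma is_derive_right f x D : is_derive x (1 : R) f D -> right_derivative f x D.
Proof.
case=> /cvg_ex[/= D' fD'] DE e e0.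
have DD' : D = D' by rewrite -DE; apply/cvg_lim.
rewrite -{}DD' in fD'; move/cvgrPdist_le: fD' => /(_ _ e0).
rewrite near_withinE => /nbhs_ballP[d /= d0 dP]; exists d => // h h0 hd.
have := dP h; rewrite /ball /= sub0r normrN gtr0_norm// => /(_ hd).
rewrite (gt_eqF h0) => /(_ isT); rewrite /GRing.scale /= mulr1 (addrC h).
rewrite -(ler_pM2l h0) -{1}(gtr0_norm h0) -normrM mulrBr mulrA divff ?gt_eqF//.
by rewrite mul1r distrC (mulrC h D) (mulrC h e).
Qed.

Lemma right_derivative_cst c x : right_derivative (fun=> c) x 0.
Proof.
by move=> e e0; exists 1 => // h h0 _ /=; rewrite subrr mul0r subrr normr0 mulr_ge0// ltW.
Qed.

Lemma right_derivative_id x : right_derivative id x 1.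
Proof.
move=> e e0; exists 1 => // h h0 _.
by rewrite mul1r (addrC x) /= addrK subrr normr0 mulr_ge0// ltW.
Qed.

Lemma right_derivativeD f g x D1 D2 : right_derivative f x D1 ->
  right_derivative g x D2 -> right_derivative (fun y => f y + g y) x (D1 + D2).
Proof.
move=> fD gD e e0; have e2 : 0 < e / 2 by rewrite divr_gt0.
have [d1 d10 fd1] := fD _ e2; have [d2 d20 gd2] := gD _ e2.
exists (Num.min d1 d2); first by rewrite lt_min d10.
move=> h h0; rewrite lt_min => /andP[hd1 hd2].
have := lerD (fd1 _ h0 hd1) (gd2 _ h0 hd2); rewrite -mulrDl -splitr.
apply: le_trans; apply: le_trans (ler_normD _ _).
by rewrite le_eqVlt; apply/orP; left; apply/eqP; congr `|_|; ring.
Qed.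

Lemma right_derivativeZ k f x D : right_derivative f x D ->
  right_derivative (fun y => k * f y) x (k * D).
Proof.
move=> fD e e0; have k0 : 0 < `|k| + 1 by rewrite ltr_wpDl.
have [d d0 fd] := fD _ (divr_gt0 e0 k0); exists d => // h h0 hd.
rewrite (_ : _ - _ = k * (f (x + h) - f x - D * h)); last by ring.
rewrite normrM; apply: le_trans (ler_wpM2l (normr_ge0 k) (fd _ h0 hd)) _.
rewrite mulrA; apply: ler_wpM2r; first exact: ltW.
by rewrite mulrA ler_pdivrMr// mulrC ler_wpM2l ?(ltW e0)// lerDl.
Qed.

Lemma right_derivativeB f g x D1 D2 : right_derivative f x D1 ->
  right_derivative g x D2 -> right_derivative (fun y => f y - g y) x (D1 - D2).
Proof.
move=> fD /(right_derivativeZ (-1)) gD; have := right_derivativeD fD gD.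
by rewrite mulN1r; under eq_fun do rewrite mulN1r.
Qed.

Lemma right_derivative_sum (I : Type) (r : seq I) (P : pred I)
    (F : I -> R -> R) (D : I -> R) x :
  (forall i, P i -> right_derivative (F i) x (D i)) ->
  right_derivative (fun y => \sum_(i <- r | P i) F i y) x
    (\sum_(i <- r | P i) D i).
Proof.
move=> FD; elim: r => [|i r IH].
  by rewrite big_nil; under eq_fun do rewrite big_nil; apply: right_derivative_cst.
rewrite big_cons; under eq_fun do rewrite big_cons.
by case: ifP => // Pi; exact: right_derivativeD (FD _ Pi) IH.
Qed.

Lemma right_derivative_near f x D e : 0 < e -> right_derivative f x D ->
  exists2 d, 0 < d & forall h, 0 < h -> h < d -> `|f (x + h) - f x| < e.
Proof.
move=> e0 fD; have [d d0 fd] := fD _ ltr01.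
have D0 : 0 < `|D| + 1 by rewrite ltr_wpDl.
exists (Num.min d (e / (`|D| + 1))); first by rewrite lt_min d0 divr_gt0.
move=> h h0; rewrite lt_min => /andP[hd]; rewrite ltr_pdivlMr// => he.
apply: le_lt_trans he; rewrite mulrDr mulr1.
have := fd _ h0 hd; rewrite mul1r.
have := ler_normD (f (x + h) - f x - D * h) (D * h).
rewrite subrK normrM (gtr0_norm h0); lra.
Qed.

(** Away from its zeros [q] keeps its sign just after [x]. At a zero, the positive part is
    1-Lipschitz and commutes with multiplication by [h > 0]. *)
Lemma right_derivative_pos q x D : right_derivative q x D ->
  right_derivative (fun y => Num.max 0 (q y)) x
    (if 0 < q x then D else if q x == 0 then Num.max 0 D else 0).
Proof.
move=> qD; case: ltgtP => [q0|q0|q0].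
- move=> e e0; have [d1 d10 qd1] := right_derivative_near q0 qD.
  have [d2 d20 qd2] := qD _ e0; exists (Num.min d1 d2).
    by rewrite lt_min d10.
  move=> h h0; rewrite lt_min => /andP[hd1 hd2].
  have := qd1 _ h0 hd1; rewrite ltr_norml => /andP[qh _].
  rewrite !max_r; [exact: qd2|exact: ltW|lra].
- move=> e e0; have q0' : 0 < - q x by rewrite oppr_gt0.
  have [d1 d10 qd1] := right_derivative_near q0' qD.
  exists d1 => // h h0 hd1; have := qd1 _ h0 hd1; rewrite ltr_norml => /andP[_ qh].
  rewrite !max_l; [|lra|lra].
  by rewrite subrr mul0r subrr normr0 mulr_ge0// ltW.
- move=> e e0; have [d d0 qd] := qD _ e0; exists d => // h h0 hd.
  have := qd _ h0 hd; rewrite -!q0 maxxx !subr0 !ler_norml => /andP[].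
  have eh : 0 <= e * h by rewrite mulr_ge0// ltW.
  case: (leP D 0) => D0; case: (leP (q (x + h)) 0) => qh.
  + by move=> *; apply/andP; split; lra.
  + have Dh : D * h <= 0 by rewrite mulr_le0_ge0// ltW.
    by move=> *; apply/andP; split; lra.
  + have Dh : 0 <= D * h by rewrite mulr_ge0// ltW.
    by move=> *; apply/andP; split; lra.
  + by move=> *; apply/andP; split; lra.
Qed.

Lemma right_derivative_ge0 f x D : right_derivative f x D ->
  (forall h, 0 < h -> f x <= f (x + h)) -> 0 <= D.
Proof.
move=> fD fx; apply/ler_addgt0Pr => e e0; have [d d0 fd] := fD _ e0.
have h0 : 0 < d / 2 by rewrite divr_gt0.
have /(fd _ h0) : d / 2 < d by rewrite ltr_pdivrMr// ltr_pMr// ltr1n.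
rewrite ler_norml => /andP[_]; have := fx _ h0.
by rewrite -(pmulr_lge0 _ h0) mulrDl; lra.
Qed.

Lemma right_derivative_cst_eq0 f x D : right_derivative f x D ->
  (forall h, 0 < h -> f (x + h) = f x) -> D = 0.
Proof.
move=> fD fx; apply/le_anti/andP; split.
  rewrite -oppr_ge0 -mulN1r.
  by apply: right_derivative_ge0 (right_derivativeZ (-1) fD) _ => h h0 /=; rewrite fx.
by apply: right_derivative_ge0 fD _ => h h0; rewrite fx.
Qed.

End RightDerivative.

(** * Growth of absolutely continuous functions *)

Section Growth.

Variable R : realType.
Implicit Types (f g : R -> R) (a b c : R).

(** Source of the closure properties below: an empty index type gives constants, one index unary
    operations, two indices sums. *)
Lemma ac_lipschitz (I : finType) (f : I -> R -> R) a b K g : 0 <= K ->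
  (forall i, absolutely_continuous a b (f i)) ->
  (forall x y, `|g y - g x| <= K * \sum_i `|f i y - f i x|) ->
  absolutely_continuous a b g.
Proof.
move=> K0 fac gf e e0.
(* The summand 1 keeps the denominator positive when [K] or the number of indices is 0. *)
have M0 : 0 < K * #|I|%:R + 1 by rewrite ltr_wpDl// mulr_ge0.
have n0 : 0 < e / (K * #|I|%:R + 1) by rewrite divr_gt0.
have /choice[d dP] i : exists d, 0 < d /\ forall J : seq (R * R),
    (forall i, i \in J -> [/\ a <= i.1, i.1 < i.2 & i.2 <= b]) ->
    pairwise (fun i j : R * R => (i.2 <= j.1) || (j.2 <= i.1)) J ->
    \sum_(i <- J) (i.2 - i.1) < d ->
    \sum_(j <- J) `|f i j.2 - f i j.1| < e / (K * #|I|%:R + 1).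
  by have [d] := fac i _ n0; exists d.
have [d1 d10 d1d] := finite_lower_bound (fun i => (dP i).1).
exists d1 => // J J1 J2 J3.
have Ji i : \sum_(j <- J) `|f i j.2 - f i j.1| <= e / (K * #|I|%:R + 1).
  by apply/ltW/(dP i).2 => //; apply: lt_le_trans (d1d i).
have : \sum_(i <- J) `|g i.2 - g i.1| <= K * (#|I|%:R * (e / (K * #|I|%:R + 1))).
  apply: (@le_trans _ _ (\sum_(j <- J) K * \sum_i `|f i j.2 - f i j.1|)).
    exact: ler_sum.
  rewrite -mulr_sumr ler_wpM2l// exchange_big /=.
  apply: le_trans (ler_sum _ (fun i _ => Ji i)) _.
  by rewrite sumr_const mulr_natl.
move/le_lt_trans; apply.
by rewrite !mulrA ltr_pdivrMr// mulrDr mulr1 (mulrC e) ltrDl.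
Qed.

Lemma ac_cst a b c : absolutely_continuous a b (fun=> c).
Proof.
apply: (@ac_lipschitz void (fun=> fun=> 0) _ _ 0) => // x y.
by rewrite subrr normr0 mul0r.
Qed.

Lemma acD f g a b : absolutely_continuous a b f -> absolutely_continuous a b g ->
  absolutely_continuous a b (fun x => f x + g x).
Proof.
move=> fac gac; apply: (@ac_lipschitz bool (fun i => if i then f else g) _ _ 1) => //.
  by case.
move=> x y; rewrite big_bool mul1r opprD addrACA; exact: ler_normD.
Qed.

Lemma acZ k f a b : absolutely_continuous a b f ->
  absolutely_continuous a b (fun x => k * f x).
Proof.
move=> fac; apply: (@ac_lipschitz unit (fun=> f) _ _ `|k|) => // x y.
by rewrite big_const card_unit /= addr0 -normrM mulrBr.
Qed.

Lemma acB f g a b : absolutely_continuous a b f -> absolutely_continuous a b g ->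
  absolutely_continuous a b (fun x => f x - g x).
Proof.
move=> fac /(acZ (-1)) gac; have := acD fac gac.
by under eq_fun do rewrite mulN1r.
Qed.

Lemma ac_sum (I : Type) (r : seq I) (F : I -> R -> R) a b :
  (forall i, absolutely_continuous a b (F i)) ->
  absolutely_continuous a b (fun x => \sum_(i <- r) F i x).
Proof.
move=> Fac; elim: r => [|i r IH].
  by under eq_fun do rewrite big_nil; exact: ac_cst.
by under eq_fun do rewrite big_cons; exact: acD (Fac i) IH.
Qed.

Lemma ac_pos f a b : absolutely_continuous a b f ->
  absolutely_continuous a b (fun x => Num.max 0 (f x)).
Proof.
move=> fac; apply: (@ac_lipschitz unit (fun=> f) _ _ 1) => // x y.
rewrite big_const card_unit /= addr0 mul1r ler_norml.
have := ler_norm (f y - f x); have := ler_norm (f x - f y).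
rewrite (distrC (f x)).
by case: (leP 0 (f x)) => ?; case: (leP 0 (f y)) => ? ? ?; apply/andP; split; lra.
Qed.

Lemma ac_id a b : absolutely_continuous a b (@id R).
Proof.
move=> e e0; exists e => // J J1 _; apply: le_lt_trans.
rewrite le_eqVlt; apply/orP; left; apply/eqP; apply: eq_big_seq => i /J1[_ ? _].
by rewrite gtr0_norm// subr_gt0.
Qed.

Lemma lebesgue_ae_imp (P Q : R -> Prop) : (forall x, P x -> Q x) ->
  {ae (@lebesgue_measure R), forall x, P x} ->
  {ae (@lebesgue_measure R), forall x, Q x}.
Proof.
by move=> PQ [A [mA A0 PA]]; exists A; split=> // x Qx; apply: PA => /PQ.
Qed.

(* Continuous induction on the right end point of [a, c].  A null set of bad
   points is covered by an open set U of small measure; the increments of f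
   over the intervals stepping out of bad points are collected in I, which
   absolute continuity controls. *)
Lemma ac_nondecreasing f a b : a <= b -> absolutely_continuous a b f ->
  {ae (@lebesgue_measure R), forall x, a <= x -> x < b ->
    exists2 D, right_derivative f x D & 0 <= D} ->
  f a <= f b.
Proof.
move=> ab fac [A [mA A0 bad]].
apply/ler_addgt0Pr => e e0.
(* The budget [e] is split in three: slope error [k] over the length [b - a], increments over [I]
   below [k], and a final slack [k]. *)
pose k := e / (2 + (b - a)).
have ba0 : 0 <= b - a by rewrite subr_ge0.
have k0 : 0 < k by rewrite divr_gt0// ltr_wpDr.
have [d d0 dP] := fac _ k0.
(* [U] contains the bad points and has measure less than [d], because [A] is null. *)
have [|U [oU AU UA]] := lebesgue_regularity_outer mA _ d0.
  by rewrite [X in (X < _)%E](_ : _ = 0%E)// ltry.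
have mU : measurable U by exact: measurable_realfun.open_measurable.
have Ud : (lebesgue_measure U < d%:E)%E.
  apply: le_lt_trans UA; rewrite (measureDI lebesgue_measure mU mA).
  rewrite [X in (_ + X)%E](_ : _ = 0%E) ?adde0//; apply/eqP.
  by rewrite -measure_le0 -A0 le_measure ?inE//; exact: measurableI.
(* The measure of [U] up to [c] pays for the lengths; as it is additive, an interval inside [U] can
   be appended at [c]. *)
pose fam c (I : seq (R * R)) :=
  [/\ forall i, i \in I -> [/\ a <= i.1, i.1 < i.2 & i.2 <= c],
      pairwise (fun i j : R * R => (i.2 <= j.1) || (j.2 <= i.1)) I
    & ((\sum_(i <- I) (i.2 - i.1))%:E <=
        lebesgue_measure (U `&` `[a, c[)%classic)%E].
(* The arbitrary slack [e'] lets [P] pass to the supremum of the points that satisfy it. *)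
pose P c := forall e', 0 < e' -> exists2 I, fam c I &
  f a <= f c + k * (c - a) + \sum_(i <- I) `|f i.2 - f i.1| + e'.
have famS c c' I : c <= c' -> fam c I -> fam c' I.
  move=> cc' [I1 I2 I3]; split=> // [i /I1[? ? ic]|].
    by split=> //; exact: le_trans cc'.
  apply: le_trans I3 _; rewrite le_measure ?inE//; try exact: measurableI.
  by apply: setIS => x /=; rewrite !in_itv /= => /andP[-> /lt_le_trans]; apply.
have fcont c e' : c <= b -> 0 < e' -> exists2 d', 0 < d' &
    forall x, a <= x -> x < c -> c - x < d' -> `|f c - f x| < e'.
  move=> cb e'0; have [d' d'0 d'P] := fac _ e'0; exists d' => // x ax xc cx.
  have := d'P [:: (x, c)]; rewrite !big_seq1 /=; apply=> //.
  by move=> i; rewrite inE => /eqP ->.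
pose X := [set c : R | a <= c <= b /\ P c]%classic.
have Xa : X a.
  split; first by rewrite lexx.
  move=> e' e'0; exists [::]; first by split; rewrite // big_nil measure_ge0.
  by rewrite big_nil subrr mulr0 !addr0 lerDl ltW.
have supX : has_sup X by split; [exists a|exists b => c [/andP[]]].
set c := sup X.
have ac : a <= c by exact: sup_upper_bound.
have cb : c <= b by apply: ge_sup; [exists a|move=> x [/andP[]]].
have Pc : P c.
  move=> e' e'0; have e2 : 0 < e' / 2 by rewrite divr_gt0.
  have [d' d'0 d'P] := fcont _ _ cb e2.
  have [x [/andP[ax xb] Px] cx] := sup_adherent d'0 supX.
  have xc : x <= c by apply: sup_upper_bound => //; split=> //; rewrite ax.
  have [I xI xP] := Px _ e2; exists I; first exact: famS xI.
  have kxc : k * (x - a) <= k * (c - a) by rewrite ler_pM2l// lerB.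
  have : `|f c - f x| <= e' / 2.
    move: xc; rewrite le_eqVlt => /predU1P[->|xc]; first by rewrite subrr normr0 ltW.
    by apply/ltW/d'P => //; rewrite ltrBlDr addrC -ltrBlDr.
  rewrite ler_norml => /andP[fl fr]; lra.
have step : c < b -> exists2 c', c < c' & X c'.
  (* Inside [U], a short interval starting at [c] is added to [I]; outside [U], the point [c] is
     good and stepping by [h] loses at most [k * h]. *)
  move=> ltcb; have [Uc|Uc] := pselect (U c).
    have /nbhs_ballP[r /= r0 rU] := open_nbhs_nbhs (conj oU Uc).
    pose h := Num.min (r / 2) (b - c).
    have h0 : 0 < h by rewrite lt_min divr_gt0//= subr_gt0.
    exists (c + h); first by rewrite ltrDl.
    split.
      apply/andP; split; first by rewrite (le_trans ac)// lerDl ltW.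
      by rewrite -lerBrDl ge_min lexx orbT.
    move=> e' e'0; have [I [I1 I2 I3] cP] := Pc _ e'0.
    exists (rcons I (c, c + h)); last first.
      rewrite big_rcons /=.
      have := ler_norm (- (f (c + h) - f c)); rewrite normrN.
      have : k * (c - a) <= k * (c + h - a) by rewrite ler_pM2l// lerB// lerDl ltW.
      move: cP; set s := \sum_(i <- I) _; lra.
    split.
    - move=> i; rewrite mem_rcons inE => /predU1P[->|/I1[? ? ic]] /=.
        by split=> //; rewrite ltrDl.
      by split=> //; rewrite (le_trans ic)// lerDl ltW.
    - by rewrite pairwise_rcons I2 andbT; apply/allP => i /I1[_ _ ic] /=; rewrite ic.
    - rewrite big_rcons /= EFinD.
      rewrite (_ : (U `&` _ = (U `&` `[a, c[) `|` `[c, c + h[)%classic); last first.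
        apply/seteqP; split=> x /=; rewrite !in_itv /=.
          move=> [Ux /andP[ax xh]]; case: (ltP x c) => xc; first by left; rewrite ax.
          by right; rewrite xh.
        move=> [[Ux /andP[-> xc]]|/andP[cx xh]].
          by split=> //=; rewrite (lt_trans xc)// ltrDl.
        split; last by rewrite xh (le_trans ac).
        apply: rU; rewrite /ball /= distrC ger0_norm ?subr_ge0//.
        have : h <= r / 2 by rewrite ge_min lexx.
        lra.
      rewrite measureU//; [|exact: measurableI|]; last first.
        apply/seteqP; split=> // x [[_ /=]]; rewrite !in_itv /=.
        by move=> /andP[_ xc] /andP[/le_lt_trans/(_ xc)]; rewrite ltxx.
      have ch : lebesgue_measure `[c, c + h[%classic = (c + h - c)%:E.
        by rewrite lebesgue_measure_itv /= lte_fin ltrDl h0 EFinB.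
      apply: leeD; first exact: I3.
      by rewrite [leRHS](_ : _ = (c + h - c)%:E).
  have [] := contrapT (fun H => Uc (AU _ (bad c H))).
    1,2: done.
  move=> D cD D0; have [d' d'0 d'P] := cD _ k0.
  pose h := Num.min (d' / 2) (b - c).
  have h0 : 0 < h by rewrite lt_min divr_gt0//= subr_gt0.
  have hd' : h < d'.
    rewrite (@le_lt_trans _ _ (d' / 2))// ?ge_min ?lexx//.
    by rewrite ltr_pdivrMr// ltr_pMr// ltr1n.
  exists (c + h); first by rewrite ltrDl.
  split.
    apply/andP; split; first by rewrite (le_trans ac)// lerDl ltW.
    by rewrite -lerBrDl ge_min lexx orbT.
  move=> e' e'0; have [I cI cP] := Pc _ e'0; exists I.
    by apply: famS cI; rewrite lerDl ltW.
  have := d'P _ h0 hd'; rewrite ler_norml => /andP[fl _].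
  have Dh : 0 <= D * h by rewrite mulr_ge0// ltW.
  move: cP fl; rewrite -addrAC mulrDr; lra.
have bc : c = b.
  apply/eqP; rewrite eq_le cb leNgt; apply/negP => /step[c' cc' Xc'].
  by have := sup_upper_bound supX Xc'; rewrite leNgt cc'.
rewrite bc in Pc; have [I [I1 I2 I3]] := Pc _ k0.
have /(dP I I1 I2) : \sum_(i <- I) (i.2 - i.1) < d.
  rewrite -lte_fin; apply: le_lt_trans Ud; apply: le_trans I3 _.
  by rewrite le_measure ?inE//; exact: measurableI.
have : e = k * (b - a) + k + k by rewrite /k; field; rewrite gt_eqF// ltr_wpDr.
by set s := \sum_(i <- I) _; lra.
Qed.

Lemma ac_growth f a b c : a <= b -> absolutely_continuous a b f ->
  {ae (@lebesgue_measure R), forall x, a <= x -> x < b ->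
    exists2 D, right_derivative f x D & c <= D} ->
  c * (b - a) <= f b - f a.
Proof.
move=> ab fac fae.
have gac : absolutely_continuous a b (fun x => f x - c * x).
  apply: (@ac_lipschitz bool (fun i x => if i then f x else x) _ _ (1 + `|c|)).
  - by rewrite addr_ge0.
  - by case=> //; exact: ac_id.
  - move=> x y; rewrite big_bool /=.
    rewrite (_ : _ - _ = (f y - f x) + c * (x - y)); last by ring.
    apply: le_trans (ler_normD _ _) _; rewrite normrM (distrC x).
    have := mulr_ge0 (normr_ge0 c) (normr_ge0 (f y - f x)).
    have := normr_ge0 (y - x); nra.
have /(ac_nondecreasing ab gac) : {ae (@lebesgue_measure R), forall x,
    a <= x -> x < b ->
    exists2 D, right_derivative (fun x => f x - c * x) x D & 0 <= D}.
  move: fae; apply: lebesgue_ae_imp => x H ax xb; have [D fD cD] := H ax xb.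
  exists (D - c); last by rewrite subr_ge0.
  have := right_derivativeB fD (right_derivativeZ c (@right_derivative_id _ x)).
  by rewrite mulr1.
lra.
Qed.

End Growth.

(** The inequality [a < theta] is strict because the derivative is two-sided: a whole neighbourhood
    of [theta] lies in the affine range. *)
Lemma is_derive_eventually_affine (R : realType) (f : R -> R) (a b c theta : R) :
  a < theta -> (forall xi, a <= xi -> f xi = b + c * (xi - a)) ->
  is_derive theta (1 : R) f c.
Proof.
move=> at_ fE; apply: (@near_eq_is_derive _ _ _ (fun xi => b + c * (xi - a))).
- near=> xi; rewrite fE// ltW//; near: xi; exact: lt_nbhsr.
- have /is_derive_eq : is_derive theta (1 : R) (cst b + c *: (id - cst a))
      (0 + c *: (1 - 0)).
    exact: is_deriveD.
  by apply; rewrite add0r subr0 /GRing.scale /= mulr1.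
Unshelve. all: by end_near. Qed.

(** * Thin flows *)

(** Follow a chosen outgoing arc from each node of [P]. By the pigeonhole principle some node
    recurs, and its smallest positive return time traces a cycle with distinct nodes. *)
Lemma forward_closed_dicycle (V E : finType) (src tgt : E -> V)
    (A : {set E}) (P : {set V}) (v0 : V) : v0 \in P ->
  (forall v, v \in P -> exists2 e, e \in A & src e = v /\ tgt e \in P) ->
  exists p, dicycle src tgt A p.
Proof.
move=> v0P nextP.
have [e0 _ _] := nextP _ v0P.
have /choice[ne neP] v : exists e, v \in P ->
    [/\ e \in A, src e = v & tgt e \in P].
  by case: (boolP (v \in P)) => [/nextP[e eA [ev eP]]|_]; [exists e|exists e0].
pose n v := tgt (ne v).
have iterP v k : v \in P -> iter k n v \in P.
  by move=> vP; elim: k => //= k /neP[].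
have [i [j [ij eqij]]] : exists i j : nat,
    (i < j)%N /\ iter i n v0 = iter j n v0.
  have : ~ injective (fun i : 'I_#|V|.+1 => iter i n v0).
    by move=> /leq_card; rewrite card_ord ltnn.
  apply: contra_notP => H i j eqij; apply/val_inj.
  by case: (ltngtP i j) => // ij; exfalso; apply: H; [exists i, j|exists j, i].
set v := iter i n v0 in eqij; have vP : v \in P by exact: iterP.
have ex_k : exists k, (0 < k)%N && (iter k n v == v).
  by exists (j - i)%N; rewrite subn_gt0 ij -iterD subnK ?eqij ?eqxx// ltnW.
case: (ex_minnP ex_k) => k /andP[k0 /eqP kv] kmin.
have walk m w : w \in P ->
    all (mem A) (map ne (traject n w m)) &&
    diwalk src tgt w (map ne (traject n w m)) (iter m n w).
  elim: m w => [|m IH] w wP /=; first exact: eqxx.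
  have [-> -> tP] := neP _ wP; rewrite eqxx /=.
  by have := IH _ tP; rewrite -iterSr.
exists (map ne (traject n v k)); split.
  by case: (k) k0.
exists v; have := walk k v vP; rewrite kv => /andP[-> ->] /=.
rewrite -map_comp (_ : map _ _ = mkseq (fun i => iter i.+1 n v) k); last first.
  apply: (@eq_from_nth _ v); rewrite size_map size_traject ?size_mkseq// => m mk.
  by rewrite (nth_map v) ?size_traject// nth_traject// nth_mkseq.
apply/mkseq_uniqP => a b; rewrite !inE => ak bk.
wlog ab : a b ak bk / (a <= b)%N => [H eqab|].
  by case: (leqP a b) => [/H|/ltnW/H H']; [apply|apply/esym/H'].
move: ab; rewrite leq_eqVlt => /predU1P[//|ab] eqab.
(* A repetition inside the period could be cut out, leaving a return time smaller than [k]. *)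
have eqv : iter (k - b.+1 + a.+1) n v = v by rewrite iterD eqab -iterD subnK.
have /kmin : (0 < k - b.+1 + a.+1)%N && (iter (k - b.+1 + a.+1) n v == v).
  by rewrite eqv eqxx addnS.
by rewrite leqNgt -(ltn_add2r b.+1) addnAC subnK// ltn_add2l ltnS ab.
Qed.

Section ThinFlows.

Variables (R : realType) (N : network R).
Local Notation V := (vertex N).
Local Notation E := (edge N).
Local Notation tl := (@edge_tail R N).
Local Notation hd := (@edge_head R N).
Local Notation nu := (@capacity R N).
Implicit Types (x y : E -> R) (v w : V) (e : E) (S : {set V}) (Es : {set E}).

Lemma rho_mono Es e a a' (y y' : R) :
  a <= a' -> y <= y' -> rho Es e a y <= rho Es e a' y'.
Proof.
move=> aa yy; have yy' : y / nu e <= y' / nu e.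
  by rewrite ler_pM2r// invr_gt0 capacity_gt0.
by rewrite /rho; case: ifP => // _; rewrite ge_max !le_max aa yy' orbT.
Qed.

Lemma rho_strict_mono Es e a a' (y y' : R) :
  a < a' -> y < y' -> rho Es e a y < rho Es e a' y'.
Proof.
move=> aa yy; have yy' : y / nu e < y' / nu e.
  by rewrite ltr_pM2r// invr_gt0 capacity_gt0.
by rewrite /rho; case: ifP => // _; rewrite gt_max !lt_max aa yy' orbT.
Qed.

(** Summation by parts: each arc enters the net outflow of its two ends only. *)
Lemma net_outflow_sum x (f : V -> R) :
  \sum_v net_outflow x v * f v = \sum_e x e * (f (tl e) - f (hd e)).
Proof.
have ends (g : E -> V) :
    \sum_v (\sum_(e | g e == v) x e) * f v = \sum_e x e * f (g e).
  rewrite (partition_big g predT)//=; apply: eq_bigr => v _.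
  by rewrite mulr_suml; apply: eq_bigr => e /eqP ->.
under eq_bigr do rewrite mulrBl.
rewrite sumrB !ends -sumrB; apply: eq_bigr => e _; by rewrite mulrBr.
Qed.

(** Used with three kinds of potential: indicators of node sets (cuts), labels divided by [lam], and
    logarithms of rate ratios. *)
Lemma flow_potential_difference u x (f : V -> R) : static_flow u x ->
  \sum_e x e * (f (hd e) - f (tl e)) = u * (f (sink N) - f (source N)).
Proof.
case=> _ x0 xs xt; apply: oppr_inj; rewrite -sumrN.
under eq_bigr do rewrite -mulrN opprB.
rewrite -net_outflow_sum (bigD1 (source N))//= (bigD1 (sink N)) /=; last first.
  by apply/eqP; exact: sink_neq_source.
rewrite big1 ?xs ?xt => [|v /andP[/eqP vs /eqP vt]]; last by rewrite x0// mul0r.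
ring.
Qed.

Lemma flow_forward u x v : 0 < u -> static_flow u x -> v <> sink N ->
  (exists2 e, 0 < x e & hd e = v) -> exists2 e, 0 < x e & tl e = v.
Proof.
move=> u0 [x0 xv xs _] vt [e xe ev]; apply: contrapT => H.
have : 0 <= net_outflow x v.
  by have [->|/eqP vs] := eqVneq v (source N); [rewrite xs ltW|rewrite xv].
rewrite /net_outflow big1 => [|e' /eqP e'v].
  rewrite sub0r oppr_ge0 leNgt => /negP; apply.
  by rewrite (bigD1 e) ?ev//= ltr_wpDr// sumr_ge0.
by apply/eqP; rewrite eq_le x0 andbT leNgt; apply/negP => xe'; apply: H; exists e'.
Qed.

Lemma flow_backward u x v : 0 < u -> static_flow u x -> v <> source N ->
  (exists2 e, 0 < x e & tl e = v) -> exists2 e, 0 < x e & hd e = v.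
Proof.
move=> u0 [x0 xv _ xt] vs [e xe ev]; apply: contrapT => H.
have : net_outflow x v <= 0.
  have [->|/eqP vt] := eqVneq v (sink N); last by rewrite xv.
  by rewrite xt oppr_le0 ltW.
rewrite /net_outflow [X in _ - X]big1 => [|e' /eqP e'v].
  rewrite subr0 leNgt => /negP; apply.
  by rewrite (bigD1 e) ?ev//= ltr_wpDr// sumr_ge0.
by apply/eqP; rewrite eq_le x0 andbT leNgt; apply/negP => xe'; apply: H; exists e'.
Qed.

Lemma flow_reaches_sink u x : 0 < u -> static_flow u x ->
  exists2 e, 0 < x e & hd e = sink N.
Proof.
move=> u0 [x0 _ _ xt]; apply: contrapT => H.
have : 0 <= net_outflow x (sink N).
  rewrite /net_outflow [X in _ - X]big1 ?subr0 ?sumr_ge0// => e /eqP ev.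
  by apply/eqP; rewrite eq_le x0 andbT leNgt; apply/negP => xe; apply: H; exists e.
by rewrite xt oppr_ge0 leNgt u0.
Qed.

(** The flow [x] is kept. Raised nodes touch no flow, so the equalities survive, and on an arc into
    a raised node the tail label inside [rho] is high enough. *)
Lemma maximal_raise_eq (E1 Es : {set E}) (l h : V -> R) x :
  thin_flow_solution E1 Es l x ->
  ~ (exists h' y', [/\ thin_flow_solution E1 Es h' y',
                       forall v, l v <= h' v & h' <> l]) ->
  (forall v, l v <= h v) -> h (source N) = l (source N) ->
  (forall e, e \in E1 -> h (hd e) <> l (hd e) ->
    [/\ x e = 0, e \notin Es & h (hd e) <= h (tl e)]) ->
  (forall e, e \in E1 -> h (tl e) <> l (tl e) -> x e = 0) ->
  h = l.
Proof.
move=> [x1 x2 x3 x4 x5] lmax lh hs hin hout; apply: contrapT => hl.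
apply: lmax; exists h, x; split=> //; split=> //; first by rewrite hs.
- move=> e eE1; have [hle|/eqP] := eqVneq (h (hd e)) (l (hd e)).
    by rewrite hle; apply: le_trans (x4 _ eE1) _; exact: rho_mono.
  by move=> /(hin _ eE1)[xe es hle]; rewrite /rho (negPf es) le_max hle.
- move=> e eE1 xe; have [->|/eqP] := eqVneq (h (hd e)) (l (hd e)).
    have [->|/eqP/(hout _ eE1) xe0] := eqVneq (h (tl e)) (l (tl e)); first exact: x5.
    by rewrite xe0 ltxx in xe.
  by move=> /(hin _ eE1)[xe0]; rewrite xe0 ltxx in xe.
Qed.

(** Otherwise all of [S] could be lifted by one amount [d], the least positive drop along an arc:
    differences inside [S] are unchanged, and arcs entering [S] have a drop of at least [d]. *)
Lemma maximal_not_raisable (E1 Es : {set E}) (l : V -> R) x S :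
  thin_flow_solution E1 Es l x ->
  ~ (exists h' y', [/\ thin_flow_solution E1 Es h' y',
                       forall v, l v <= h' v & h' <> l]) ->
  source N \notin S ->
  (forall e, e \in E1 -> hd e \in S ->
    [/\ x e = 0, e \notin Es, l (hd e) <= l (tl e) &
        tl e \notin S -> l (hd e) < l (tl e)]) ->
  (forall e, e \in E1 -> tl e \in S -> x e = 0) ->
  forall v, v \notin S.
Proof.
move=> lx lmax sS hin hout v; apply/negP => vS.
have [d d0 dP] := @finite_positive_gap R E (fun e => l (tl e) - l (hd e)).
pose h w := if w \in S then l w + d else l w.
have hS w : h w <> l w -> w \in S by rewrite /h; case: ifP.
have : h = l.
  apply: (maximal_raise_eq lx lmax) => [w||e eE1 /hS eS|e eE1 /hS]; last 2 first.
  - have [-> -> le lt] := hin _ eE1 eS; rewrite /h eS; split=> //.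
    case: ifPn => tS; first by rewrite lerD2r.
    by rewrite -lerBrDl dP// subr_gt0 lt.
  - exact: hout.
  - by rewrite /h; case: ifP => // _; rewrite lerDl ltW.
  - by rewrite /h (negPf sS).
move/(congr1 (fun g => g v)); rewrite /h vS => /eqP.
by rewrite -subr_eq0 addrAC subrr add0r gt_eqF.
Qed.

Lemma diwalk_closed (E1 : {set E}) (Z : {set V}) v p w e :
  (forall e, e \in E1 -> tl e \in Z -> hd e \in Z) ->
  all (mem E1) p -> diwalk tl hd v p w -> e \in p -> hd e \in Z -> w \in Z.
Proof.
move=> Zcl; elim: p v => //= a p IH v /andP[aE pE] /andP[/eqP av pw].
rewrite inE => /predU1P[-> aZ|ep eZ]; last exact: IH pE pw ep eZ.
elim: p (hd a) aZ pE pw {IH} => [|b p IH] u uZ /=; first by move=> _ /eqP <-.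
move=> /andP[bE pE] /andP[/eqP bu pw]; apply: IH pw => //.
by apply: Zcl => //; rewrite bu.
Qed.

(* No flow enters the set Z of nodes with nonpositive value, so t is not in Z
   and Z cannot be left within E1; hence no arc of Es enters Z, and all values
   on Z could be lifted to one small positive constant. *)
Lemma thin_flow_direction_gt0 (E1 Es : {set E}) (l : V -> R) :
  valid_configuration E1 Es -> is_thin_flow_direction E1 Es l ->
  forall v, 0 < l v.
Proof.
move=> [_ _ Est _] [x [lx lmax]] v.
have [fx x2 x3 x4 x5] := lx; have x0 : forall e, 0 <= x e by case: fx.
have u0 := inflow_gt0 N.
pose Z := finset.finset (fun v => l v <= 0).
have Zin e : hd e \in Z -> x e = 0.
  rewrite inE => eZ; apply/eqP; rewrite eq_le x0 andbT leNgt; apply/negP => xe.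
  have eE1 : e \in E1 by apply: contrapT => /negP /x2 xe0; rewrite xe0 ltxx in xe.
  have : x e / nu e <= 0.
    by apply: le_trans eZ; rewrite x5// /rho; case: ifP => // _; rewrite le_max lexx orbT.
  by rewrite leNgt divr_gt0// capacity_gt0.
have Zt : sink N \notin Z.
  apply/negP => tZ; have [e xe et] := flow_reaches_sink u0 fx.
  by rewrite Zin ?et// ltxx in xe.
have Zs : source N \notin Z by rewrite inE x3 leNgt ltr01.
have Zout e : tl e \in Z -> x e = 0.
  move=> eZ; apply/eqP; rewrite eq_le x0 andbT leNgt; apply/negP => xe.
  have [|e' xe' e'e] := @flow_backward _ _ (tl e) u0 fx _ (ex_intro2 _ _ e xe erefl).
    by move=> es; rewrite es (negPf Zs) in eZ.
  by rewrite Zin ?e'e// ltxx in xe'.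
have Zcl e : e \in E1 -> tl e \in Z -> hd e \in Z.
  move=> eE1 eZ; have := x4 _ eE1; rewrite Zout// inE => /le_trans; apply.
  rewrite /rho mul0r; case: ifP => // _; rewrite ge_max lexx andbT.
  by move: eZ; rewrite inE.
have ZEs e : e \in Es -> hd e \notin Z.
  move=> /Est[p /and3P[pE1 pw _] ep]; apply/negP => eZ.
  by rewrite (diwalk_closed Zcl pE1 pw ep eZ) in Zt.
(* [d] is at most every positive label, so a tail outside [Z] is at least as high as a head lifted
   to [d]. *)
have [d d0 dP] := finite_positive_gap l.
pose h w := if w \in Z then d else l w.
have hZ w : h w <> l w -> w \in Z by rewrite /h; case: ifP.
have hl : h = l.
  apply: (maximal_raise_eq lx lmax) => [w||e eE1 /hZ eZ|e eE1 /hZ]; last 2 first.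
  - rewrite Zin//; split=> //; first by apply: contraL eZ; exact: ZEs.
    by rewrite /h eZ; case: ifPn => //; rewrite inE -ltNge => /dP.
  - exact: Zout.
  - by rewrite /h; case: ifP => //; rewrite inE => /le_trans -> //; exact: ltW.
  - by rewrite /h (negPf Zs).
by rewrite ltNge; apply/negP => vZ; have := vZ; rewrite -hl /h inE vZ leNgt d0.
Qed.

(* On U the two solutions are exchanged: the cut of U carries no flow, so gluing
   (h, y) inside U to (l, x) outside is a solution that dominates l. *)
Lemma thin_flow_direction_dominates (E1 Es : {set E}) (l h : V -> R) :
  is_thin_flow_direction E1 Es l -> is_thin_flow_direction E1 Es h ->
  forall v, h v <= l v.
Proof.
move=> [x [lx lmax]] [y [hy _]] v0; rewrite leNgt; apply/negP => v0U.
have [fx x2 x3 x4 x5] := lx; have [fy y2 y3 y4 y5] := hy.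
have x0 : forall e, 0 <= x e by case: fx.
have y0 : forall e, 0 <= y e by case: fy.
have u0 := inflow_gt0 N.
pose U := finset.finset (fun v => l v < h v).
have E1x e : 0 < x e -> e \in E1.
  by move=> xe; apply: contrapT => /negP /x2 xe0; rewrite xe0 ltxx in xe.
have E1y e : 0 < y e -> e \in E1.
  by move=> ye; apply: contrapT => /negP /y2 ye0; rewrite ye0 ltxx in ye.
(* The head is higher under [h] and the tail is not, so [h] needs more flow on the arc. *)
have Uin e : hd e \in U -> tl e \notin U -> 0 < x e -> x e < y e.
  rewrite !inE -leNgt => eU tU xe; have eE1 := E1x _ xe.
  rewrite ltNge; apply/negP => yx.
  have := lt_le_trans eU (y4 _ eE1); rewrite (x5 _ eE1 xe) ltNge.
  by rewrite rho_mono.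
have Uin' e : hd e \in U -> tl e \notin U -> x e <= y e.
  move=> eU tU; have := x0 e; rewrite le_eqVlt => /predU1P[<-//|].
  by move/(Uin _ eU tU)/ltW.
have Uout e : hd e \notin U -> tl e \in U -> y e <= x e.
  rewrite !inE -leNgt => eU tU; rewrite leNgt; apply/negP => xy.
  have ye := le_lt_trans (x0 e) xy; have eE1 := E1y _ ye.
  have := le_trans eU (x4 _ eE1); rewrite (y5 _ eE1 ye) leNgt.
  by rewrite rho_strict_mono.
pose f v : R := (v \in U)%:R.
(* Both flows have the same value, so their net flows into [U] agree; by [Uin'] and [Uout] every
   term of the difference is nonnegative, hence zero. *)
have cut : \sum_e (y e - x e) * (f (hd e) - f (tl e)) = 0.
  under eq_bigr do rewrite mulrBl.
  rewrite sumrB (flow_potential_difference _ fx) (flow_potential_difference _ fy).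
  exact: subrr.
have cut0 e : (y e - x e) * (f (hd e) - f (tl e)) = 0.
  apply: (psumr_eq0P _ cut) => // e' _; rewrite /f.
  case: (boolP (hd e' \in U)) => h1; case: (boolP (tl e' \in U)) => h2 /=.
  - by rewrite subrr mulr0.
  - by rewrite subr0 mulr1 subr_ge0 Uin'.
  - by rewrite sub0r mulrN1 opprB subr_ge0 Uout.
  - by rewrite subrr mulr0.
have xin e : hd e \in U -> tl e \notin U -> x e = y e /\ x e = 0.
  move=> h1 h2; have := cut0 e; rewrite /f h1 (negPf h2) subr0 mulr1.
  move/subr0_eq => yx; split=> //; apply/eqP; rewrite eq_le x0 andbT leNgt.
  by apply/negP => /(Uin _ h1 h2); rewrite yx ltxx.
(* The source lies outside [U] and no flow of [x] enters [U], so none can leave it. *)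
have xout e : hd e \notin U -> tl e \in U -> x e = y e /\ x e = 0.
  move=> h1 h2; have := cut0 e; rewrite /f (negPf h1) h2 sub0r mulrN1 opprB.
  move/subr0_eq => xy; split=> //; apply/eqP; rewrite eq_le x0 andbT.
  have := flow_potential_difference f fx.
  have -> : f (source N) = 0 by rewrite /f inE x3 y3 ltxx.
  rewrite subr0 => sx.
  have : 0 <= \sum_e x e * (f (hd e) - f (tl e)) by rewrite sx mulr_ge0 ?ler0n ?ltW.
  have others : \sum_(e' | e' != e) x e' * (f (hd e') - f (tl e')) <= 0.
    apply: sumr_le0 => e' _; rewrite /f.
    case: (boolP (hd e' \in U)) => k1; case: (boolP (tl e' \in U)) => k2 /=.
    - by rewrite subrr mulr0.
    - by have [_ ->] := xin _ k1 k2; rewrite mul0r.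
    - by rewrite sub0r mulrN1 oppr_le0.
    - by rewrite subrr mulr0.
  have fe : f (hd e) - f (tl e) = -1 by rewrite /f (negPf h1) h2 sub0r.
  rewrite (bigD1 e)//= fe; lra.
pose k v := if v \in U then h v else l v.
pose z e := if hd e \in U then y e else x e.
have net_z v : net_outflow z v = if v \in U then net_outflow y v else net_outflow x v.
  rewrite /net_outflow; case: ifPn => vU; congr (_ - _);
    apply: eq_bigr => e /eqP ev; rewrite /z.
  - by case: ifPn => // eU; have [] := xout e eU; rewrite ?ev.
  - by rewrite ev vU.
  - by case: ifPn => // eU; have [] := xin e eU; rewrite ?ev.
  - by rewrite ev (negPf vU).
have kz : thin_flow_solution E1 Es k z.
  split.
  - case: fx fy => [_ a1 a2 a3] [_ b1 b2 b3]; split.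
    + by move=> e; rewrite /z; case: ifP.
    + by move=> v vs vt; rewrite net_z a1// b1//; case: ifP.
    + by rewrite net_z a2 b2; case: ifP.
    + by rewrite net_z a3 b3; case: ifP.
  - by move=> e eE1; rewrite /z; case: ifP => _; [apply: y2|apply: x2].
  - by rewrite /k x3 y3; case: ifP.
  - move=> e eE1; rewrite /k /z; case: ifPn => h1; case: ifPn => h2.
    + exact: y4.
    + have [xy ye] := xin _ h1 h2; apply: le_trans (y4 _ eE1) _.
      by apply: rho_mono => //; rewrite leNgt; move: h2; rewrite inE.
    + have [xy ye] := xout _ h1 h2; apply: le_trans (x4 _ eE1) _.
      by apply: rho_mono => //; apply: ltW; move: h2; rewrite inE.
    + exact: x4.
  - move=> e eE1; rewrite /k /z; case: ifPn => h1; case: ifPn => h2.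
    + exact: y5.
    + by have [<- ->] := xin _ h1 h2; rewrite ltxx.
    + by have [_ ->] := xout _ h1 h2; rewrite ltxx.
    + exact: x5.
apply: lmax; exists k, z; split=> // [v|kl].
  by rewrite /k; case: ifPn => //; rewrite inE => /ltW.
have := congr1 (fun g => g v0) kl; rewrite /k inE v0U => /eqP.
by rewrite gt_eqF.
Qed.

Lemma thin_flow_direction_unique (E1 Es : {set E}) (l h : V -> R) :
  is_thin_flow_direction E1 Es l -> is_thin_flow_direction E1 Es h -> l = h.
Proof.
move=> dl dh; apply/funext => v; apply/le_anti.
by rewrite (thin_flow_direction_dominates dh dl) (thin_flow_direction_dominates dl dh).
Qed.

End ThinFlows.

(** * The potential *)

Section ArcInequalities.

Variable R : realType.
Implicit Types (a b : R).

Lemma ln_lt_subr1 a : 0 < a -> a != 1 -> ln a < a - 1.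
Proof.
move=> a0 a1; rewrite ltrBrDl -[X in _ < X](lnK a0).
by apply: expR_gt1Dx; rewrite ln_eq0.
Qed.

(** The inequality [ln z <= z - 1] at [z = b / a], multiplied by [a]: relative entropy is
    nonnegative pointwise. *)
Lemma log_sum a b : 0 < a -> 0 < b -> a - b <= a * (ln a - ln b) ?= iff (a == b).
Proof.
move=> a0 b0; have [->|ab] := eqVneq a b; first by rewrite !subrr mulr0; apply/leifP.
apply/leifP.
have : ln (b / a) < b / a - 1.
  rewrite ln_lt_subr1 ?divr_gt0// -subr_eq0; apply: contra ab => /eqP H.
  by apply/eqP; rewrite -[RHS](divfK (lt0r_neq0 a0)) (subr0_eq H) mul1r.
rewrite ln_div ?posrE// -(ltr_pM2l a0) => H; rewrite -ltrN2 opprB.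
move: H; rewrite !mulrBr mulr1 (mulrC a (b / a)) divfK ?gt_eqF//; lra.
Qed.

(** For an arc from v to w, [lv] and [lw] stand for [lam] and [rv] and [rw] for the ratios [d / lam]
    at its ends. In each lemma [t] is the arc flow times the increase of the logarithm of the ratio,
    minus the slope of the arc cost. *)
Variables (nu lv lw rv rw : R).
Hypotheses (nu0 : 0 < nu) (lv0 : 0 < lv) (lw0 : 0 < lw) (rv0 : 0 < rv) (rw0 : 0 < rw).

Let kappaE : Num.max 0 (lw / lv - 1) * (rv * lv) = rv * Num.max 0 (lw - lv).
Proof.
case: (leP lw lv) => h.
  by rewrite !max_l ?mul0r ?mulr0// ?subr_le0 ?ler_pdivrMr ?mul1r.
rewrite !max_r ?subr_ge0 ?ler_pdivlMr ?mul1r ?(ltW h)//.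
by field; rewrite gt_eqF.
Qed.

Lemma free_arc :
  let t := nu * (rw * lw) * (ln rw - ln rv) - nu * lw * (rw - rv) in
  0 <= t /\ (t = 0 -> rw = rv).
Proof.
move=> t; have [H1 H2] := log_sum rw0 rv0.
have tE : t = nu * lw * (rw * (ln rw - ln rv) - (rw - rv)) by rewrite /t; ring.
have c0 : 0 < nu * lw by rewrite mulr_gt0.
rewrite tE; split; first by rewrite mulr_ge0 ?(ltW c0)// subr_ge0.
move/eqP; rewrite mulf_eq0 (gt_eqF c0) /= subr_eq0 eq_sym H2; exact: eqP.
Qed.

(** The surplus over [free_arc] is [nu * rv] times the positive part of [lv - lw], so equality also
    forces [lv <= lw]. *)
Lemma saturated_arc :
  let t := nu * (rw * lw) * (ln rw - ln rv) -
    nu * (rw * lw - rv * lv - Num.max 0 (lw / lv - 1) * (rv * lv)) in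
  0 <= t /\ (t = 0 -> rw = rv /\ lv <= lw).
Proof.
move=> t; have [H1 H2] := free_arc.
set t' := (X in 0 <= X) in H1 H2.
have tE : t = t' + nu * rv * (lv - lw + Num.max 0 (lw - lv)).
  by rewrite /t kappaE /t'; ring.
have m0 : 0 <= lv - lw + Num.max 0 (lw - lv).
  by rewrite -[lv - lw]opprB addrC subr_ge0 le_max lexx orbT.
have t0 : 0 <= nu * rv * (lv - lw + Num.max 0 (lw - lv)).
  by rewrite !mulr_ge0// ltW.
rewrite tE; split; first exact: addr_ge0.
move/eqP; rewrite paddr_eq0// => /andP[/eqP/H2 -> ]; rewrite mulf_eq0 gt_eqF ?mulr_gt0//=.
by case: (leP (lw - lv) 0) => h /eqP h'; split=> //; lra.
Qed.

(** Only [lv < lw] with [0 < x] is delicate: the logarithmic factor is then negative, so [x] may be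
    replaced by its upper bound, and strictness in [log_sum] makes [t] positive. *)
Lemma unsaturated_arc x : 0 <= x -> (0 < x -> rw * lw = rv * lv /\ x <= nu * (rw * lw)) ->
  let t := x * (ln rw - ln rv) - nu * (0 - Num.max 0 (lw / lv - 1) * (rv * lv)) in
  0 <= t /\ (t = 0 -> lw <= lv /\ (0 < x -> rw = rv)).
Proof.
move=> x0 xP t.
have {t}-> : t = x * (ln rw - ln rv) + nu * rv * Num.max 0 (lw - lv).
  by rewrite /t kappaE; ring.
have nr0 : 0 < nu * rv by rewrite mulr_gt0.
move: x0; rewrite le_eqVlt => /predU1P[<-|x0].
  rewrite mul0r add0r ltxx; split.
    by rewrite mulr_ge0 ?(ltW nr0)// le_max lexx.
  move/eqP; rewrite mulf_eq0 (gt_eqF nr0)/=.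
  by case: (leP (lw - lv) 0) => h /eqP h'; split=> //; lra.
have [eqr xle] := xP x0.
case: (leP lw lv) => lwv.
  rewrite max_l ?subr_le0// mulr0 addr0.
  have rvw : rv <= rw by rewrite -(ler_pM2r lw0) eqr ler_pM2l.
  have lnle : 0 <= ln rw - ln rv by rewrite subr_ge0 ler_ln.
  split; first by rewrite mulr_ge0// ltW.
  move/eqP; rewrite mulf_eq0 (gt_eqF x0) /= subr_eq0 => /eqP/ln_inj H.
  by split=> // _; apply: H.
have rwv : rw < rv by rewrite -(ltr_pM2r lw0) eqr ltr_pM2l.
rewrite max_r ?subr_ge0 ?(ltW lwv)//.
have [_ /esym] := log_sum rw0 rv0; rewrite (lt_eqF rwv) => /esym neq.
have [H1 _] := log_sum rw0 rv0.
have {neq}H : rw - rv < rw * (ln rw - ln rv) by rewrite lt_neqAle neq.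
have lnlt : ln rw - ln rv < 0 by rewrite subr_lt0 ltr_ln.
have c0 : 0 < nu * lw by rewrite mulr_gt0.
have E1 : nu * rv * (lw - lv) = nu * lw * (rv - rw).
  have -> : nu * rv * (lw - lv) = nu * (rv * lw - rv * lv) by ring.
  by rewrite -eqr; ring.
have E2 : nu * (rw * lw) * (ln rw - ln rv) <= x * (ln rw - ln rv).
  by rewrite ler_wnM2r// ltW.
have E3 : nu * lw * (rw - rv) < nu * lw * (rw * (ln rw - ln rv)) by rewrite ltr_pM2l.
have pos : 0 < x * (ln rw - ln rv) + nu * rv * (lw - lv).
  rewrite E1; have E4 : nu * lw * (rw - rv) = - (nu * lw * (rv - rw)) by ring.
  have E5 : nu * lw * (rw * (ln rw - ln rv)) = nu * (rw * lw) * (ln rw - ln rv).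
    by ring.
  by move: E2 E3; rewrite E4 E5; lra.
by split; [exact: ltW|move=> H0; rewrite H0 ltxx in pos].
Qed.

End ArcInequalities.

Section Potential.

Variables (R : realType) (G : generalized_network R).
Local Notation V := (vertex G).
Local Notation E := (edge G).
Local Notation tl := (@edge_tail R G).
Local Notation hd := (@edge_head R G).
Local Notation nu := (@capacity R G).
Local Notation F := (free_arcs G).
Implicit Types (x y : E -> R) (l d : V -> R) (v w : V) (e : E).

Definition excess l e := l (hd e) - l (tl e) - transit e.

Lemma mem_active l e : (e \in active_arcs l) = (e \in F) || (0 <= excess l e).
Proof. by rewrite !inE /excess subr_ge0. Qed.

Lemma mem_queueing l e : (e \in queueing_arcs l) = (e \in F) || (0 < excess l e).
Proof. by rewrite !inE /excess subr_gt0. Qed.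

(* Arcs on cycles of a valid configuration are not queueing, so the labels
   along such a cycle would increase by its transit times. *)
Lemma active_acyclic l : feasible_labeling l ->
  ~ exists p, dicycle tl hd (active_arcs l) p.
Proof.
move=> [_ _ _ cyc] [p pcyc].
have tight e : e \in p -> l (hd e) = l (tl e) + transit e.
  move=> ep; have [_ [v /and3P[/allP/(_ _ ep) eA _ _]]] := pcyc.
  have : e \notin queueing_arcs l by apply/negP => /cyc; apply; exists p.
  move: eA; rewrite /= mem_active mem_queueing.
  case: (e \in F) => //= q0; rewrite -leNgt /excess in q0 *; move: q0; lra.
have walk q v w : {subset q <= p} -> diwalk tl hd v q w ->
    l w = l v + \sum_(e <- q) transit e.
  elim: q v => [|e q IH] v qp /=; first by rewrite big_nil addr0 => /eqP ->.
  move=> /andP[/eqP ev qw]; rewrite big_cons (IH (hd e))//.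
    by rewrite tight ?qp ?mem_head// ev addrA.
  by move=> a aq; rewrite qp// inE aq orbT.
have [_ [v /and3P[pA pw pu]]] := pcyc.
have sum0 : \sum_(e <- p) transit e = 0.
  have := walk p v v (fun _ => id) pw; lra.
apply: (no_zero_transit_cycle (n := G) (p := p)).
  have [pn _] := pcyc; split=> //; exists v; rewrite pw pu !andbT.
  by apply/allP => e _; rewrite /= inE.
move=> e ep; apply/eqP; rewrite eq_le transit_ge0 andbT -sum0.
by rewrite (big_rem e)//= lerDl sumr_ge0// => a _; exact: transit_ge0.
Qed.

(** From a head with ratio other than 1, follow [y] forward: the ratio stays constant, so the sink
    is never met and an active cycle arises. *)
Lemma flow_ratio_eq1 l y (r : V -> R) : feasible_labeling l ->
  static_flow (inflow G) y -> r (source G) = 1 -> r (sink G) = 1 ->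
  (forall e, 0 < y e -> e \in active_arcs l /\ r (hd e) = r (tl e)) ->
  forall e, 0 < y e -> r (hd e) = 1.
Proof.
move=> fl fy rs rt yr e ye; apply: contrapT => re.
apply: (active_acyclic fl).
pose P := finset.finset (fun v => `[< r v <> 1 /\ exists2 e, 0 < y e & hd e = v >]).
apply: (@forward_closed_dicycle _ _ _ _ _ P (hd e)).
  by rewrite inE; apply/asboolP; split=> //; exists e.
move=> v; rewrite inE => /asboolP[rv vin].
have [|e' ye' e'v] := flow_forward (inflow_gt0 G) fy _ vin.
  by move=> vt; apply: rv; rewrite vt.
have [eA e'r] := yr _ ye'; exists e' => //; split=> //.
by rewrite inE; apply/asboolP; rewrite e'r e'v; split=> //; exists e'.
Qed.

Variable lam : V -> R.
Hypothesis lam0 : forall v, 0 < lam v.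

(* The term in l (tl e) makes the cost of an arc with lam (hd e) > lam (tl e)
   proportional to l (hd e) / lam (hd e) - l (tl e) / lam (tl e), up to a constant,
   while the arc queues, and nonincreasing while it is inactive. *)
Definition arc_cost l e :=
  if e \in F then nu e * lam (hd e) * (l (hd e) / lam (hd e) - l (tl e) / lam (tl e))
  else nu e * (Num.max 0 (excess l e) -
               Num.max 0 (lam (hd e) / lam (tl e) - 1) * l (tl e)).

Definition potential l :=
  inflow G * (l (sink G) / lam (sink G) - l (source G) / lam (source G)) -
  \sum_e arc_cost l e.

(** The right derivative of [arc_cost] in direction [d], written in terms of the configuration
    instead of the labeling, so that only finitely many slopes can occur. *)
Definition arc_slope (E1 Es : {set E}) d e :=
  if e \in F then nu e * lam (hd e) * (d (hd e) / lam (hd e) - d (tl e) / lam (tl e))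
  else nu e * ((if e \in Es then d (hd e) - d (tl e)
                else if e \in E1 then Num.max 0 (d (hd e) - d (tl e)) else 0) -
               Num.max 0 (lam (hd e) / lam (tl e) - 1) * d (tl e)).

Definition potential_slope (E1 Es : {set E}) d :=
  inflow G * (d (sink G) / lam (sink G) - d (source G) / lam (source G)) -
  \sum_e arc_slope E1 Es d e.

Section Slope.
Variables (l : R -> V -> R) (theta : R) (d : V -> R).
Hypothesis ld : forall v, right_derivative (fun xi => l xi v) theta (d v).

Lemma right_derivative_excess e :
  right_derivative (fun xi => excess (l xi) e) theta (d (hd e) - d (tl e)).
Proof.
have := right_derivativeB (right_derivativeB (ld (hd e)) (ld (tl e)))
  (right_derivative_cst (transit e) theta).
by rewrite subr0.
Qed.

Lemma right_derivative_potential :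
  right_derivative (fun xi => potential (l xi)) theta
    (potential_slope (active_arcs (l theta)) (queueing_arcs (l theta)) d).
Proof.
have div v : right_derivative (fun xi => l xi v / lam v) theta (d v / lam v).
  have := right_derivativeZ (lam v)^-1 (ld v); rewrite mulrC.
  by under eq_fun do rewrite mulrC.
apply: right_derivativeB.
  exact/right_derivativeZ/right_derivativeB.
apply: right_derivative_sum => e _; rewrite /arc_cost /arc_slope.
case: ifPn => eF; first exact/right_derivativeZ/right_derivativeB.
apply/right_derivativeZ/right_derivativeB; last exact: right_derivativeZ.
have := right_derivative_pos (right_derivative_excess e).
rewrite mem_active mem_queueing (negPf eF) /=.
by rewrite (le_eqVlt 0) (eq_sym 0); case: (0 < _); rewrite ?orbF.
Qed.

End Slope.

Lemma ac_potential (l : R -> V -> R) a b :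
  (forall v, absolutely_continuous a b (fun xi => l xi v)) ->
  absolutely_continuous a b (fun xi => potential (l xi)).
Proof.
move=> lac.
have div v : absolutely_continuous a b (fun xi => l xi v / lam v).
  by have := acZ (lam v)^-1 (lac v); under eq_fun do rewrite mulrC.
apply: acB; first exact/acZ/acB.
apply: ac_sum => e; rewrite /arc_cost; case: (e \in F); first exact/acZ/acB.
apply/acZ/acB; last exact: acZ.
by apply/ac_pos/acB; [exact: acB|exact: ac_cst].
Qed.


Definition complementary y l := forall e, e \notin F ->
  (0 < y e -> 0 <= excess l e) /\
  (y e < nu e * lam (hd e) -> excess l e <= 0).

(** * Steady thin flows as dual certificates for the potential *)

Section Duality.

Variable y : E -> R.
Hypothesis ylam : thin_flow_solution [set: E] F lam y.

Let y0 e : 0 <= y e. Proof. by have [[]] := ylam. Qed.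

Lemma steady_flow_free e : e \in F -> y e = nu e * lam (hd e).
Proof.
move=> eF; have [_ _ _ y4 y5] := ylam.
have := y4 e (finset.in_setT e); have := y5 e (finset.in_setT e).
rewrite /rho eF => yeq yle.
have ye : 0 < y e.
  by have := lt_le_trans (lam0 _) yle; rewrite pmulr_lgt0// invr_gt0 capacity_gt0.
by rewrite yeq// mulrC divfK// gt_eqF// capacity_gt0.
Qed.

Lemma steady_flow_le e : y e <= nu e * lam (hd e).
Proof.
have [_ _ _ _ y5] := ylam; have n0 := capacity_gt0 e.
have := y0 e; rewrite le_eqVlt => /predU1P[<-|ye]; first by rewrite mulr_ge0// ltW.
rewrite y5 ?finset.in_setT// -ler_pdivrMl// mulrC /rho.
by case: ifP => // _; rewrite le_max lexx orbT.
Qed.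

Lemma steady_flow_increasing e : lam (tl e) < lam (hd e) -> y e = nu e * lam (hd e).
Proof.
move=> ltl; have [_ _ _ y4 y5] := ylam; have n0 := capacity_gt0 e.
apply/le_anti; rewrite steady_flow_le/= mulrC -ler_pdivlMr//.
have := y4 e (finset.in_setT e); rewrite /rho; case: ifP => // _.
by rewrite le_max => /orP[|//]; rewrite leNgt ltl.
Qed.

Lemma steady_flow_decreasing e : e \notin F -> lam (hd e) < lam (tl e) -> y e = 0.
Proof.
move=> eF ltl; have [_ _ _ _ y5] := ylam.
apply/eqP; rewrite eq_le y0 andbT leNgt; apply/negP => ye.
have := y5 e (finset.in_setT e) ye; rewrite /rho (negPf eF) => H.
by move: ltl; rewrite H ltNge le_max lexx.
Qed.

(** With [c = y e / lam (hd e)], which lies between 0 and [nu e], and q the excess, this is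
    [(nu e - c) q^+ + c q^-]; it vanishes exactly under complementary slackness. *)
Definition duality_gap l e :=
  nu e * Num.max 0 (excess l e) - y e / lam (hd e) * excess l e.

Lemma duality_gap_ge0 l e : 0 <= duality_gap l e.
Proof.
have n0 := capacity_gt0 e; have l0 := lam0 (hd e).
have c0 : y e / lam (hd e) <= nu e by rewrite ler_pdivrMr// steady_flow_le.
have c1 : 0 <= y e / lam (hd e) by rewrite divr_ge0// ltW.
rewrite /duality_gap; case: (leP (excess l e) 0) => q0; nra.
Qed.

Lemma duality_gap_eq0 l e : duality_gap l e = 0 <->
  (0 < y e -> 0 <= excess l e) /\ (y e < nu e * lam (hd e) -> excess l e <= 0).
Proof.
have n0 := capacity_gt0 e; have l0 := lam0 (hd e).
have il0 : 0 < (lam (hd e))^-1 by rewrite invr_gt0.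
rewrite -ltr_pdivrMr// -(pmulr_lgt0 (y e) il0).
have c0 : y e / lam (hd e) <= nu e by rewrite ler_pdivrMr// steady_flow_le.
have c1 : 0 <= y e / lam (hd e) by rewrite divr_ge0// ltW.
rewrite /duality_gap; move: (_ / _) c0 c1 => c c0 c1.
case: (ltgtP (excess l e) 0) => q0; split.
- move=> H; split=> // c2; exfalso; nra.
- move=> [H _]; move: c1; rewrite le_eqVlt => /predU1P[<-|/H]; first by ring.
  by [].
- move=> H; split=> // c2; exfalso; nra.
- move=> [_ H]; move: c0; rewrite le_eqVlt => /predU1P[->|/H]; first by ring.
  by [].
- by [].
- by rewrite q0 !mulr0 subr0.
Qed.

(* The part of the bracket that multiplies l (tl e) cancels in each of the three
   cases lam (hd e) <, =, > lam (tl e). *)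
Lemma arc_duality l e : y e * (l (hd e) / lam (hd e) - l (tl e) / lam (tl e)) -
    arc_cost l e =
  if e \in F then 0 else y e * transit e / lam (hd e) - duality_gap l e.
Proof.
rewrite /arc_cost; case: ifPn => eF; first by rewrite steady_flow_free// subrr.
have lh := lam0 (hd e); have lt := lam0 (tl e).
have lhE : l (hd e) = l (tl e) + transit e + excess l e by rewrite /excess; ring.
have key : y e * (1 / lam (hd e) - 1 / lam (tl e)) +
    nu e * Num.max 0 (lam (hd e) / lam (tl e) - 1) = 0.
  case: (ltgtP (lam (hd e)) (lam (tl e))) => h.
  - rewrite steady_flow_decreasing// mul0r max_l ?mulr0 ?addr0//.
    by rewrite subr_le0 ler_pdivrMr// mul1r ltW.
  - rewrite steady_flow_increasing// max_r; last first.
      by rewrite subr_ge0 ler_pdivlMr// mul1r ltW.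
    by field; rewrite !gt_eqF.
  - by rewrite h divff ?gt_eqF// !subrr maxxx !mulr0 addr0.
rewrite /duality_gap {1}lhE.
transitivity (y e * transit e / lam (hd e) -
  (nu e * Num.max 0 (excess l e) - y e / lam (hd e) * excess l e) +
  l (tl e) * (y e * (1 / lam (hd e) - 1 / lam (tl e)) +
    nu e * Num.max 0 (lam (hd e) / lam (tl e) - 1))).
  by move: (Num.max _ _) (Num.max _ _) => m1 m2; field; rewrite !gt_eqF.
by rewrite key mulr0 addr0.
Qed.

Definition dual_bound := \sum_(e | e \notin F) y e * transit e / lam (hd e).

(** The flow identity for [y] with node potentials [l v / lam v] spreads the sink term over the
    arcs, where [arc_duality] applies. *)
Lemma potential_duality l :
  potential l = dual_bound - \sum_(e | e \notin F) duality_gap l e.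
Proof.
have [fy _ _ _ _] := ylam.
rewrite /potential -(flow_potential_difference (fun v => l v / lam v) fy) -!sumrB.
rewrite [RHS]big_mkcond; apply: eq_bigr => e _; rewrite arc_duality.
by case: (e \in F).
Qed.

Lemma potential_le l : potential l <= dual_bound.
Proof.
by rewrite potential_duality gerBl sumr_ge0// => e _; exact: duality_gap_ge0.
Qed.

Lemma potential_eq l : potential l = dual_bound <-> complementary y l.
Proof.
rewrite potential_duality; split.
  rewrite -[RHS]subr0 => /addrI/oppr_inj /psumr_eq0P H e eF.
  by apply/duality_gap_eq0/H => // a _; exact: duality_gap_ge0.
by move=> H; rewrite big1 ?subr0// => e /H/duality_gap_eq0.
Qed.

End Duality.

Hypothesis lam_source : lam (source G) = 1.

(** * The slope of the potential along a thin flow *)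

Section Direction.

Variables (E1 Es : {set E}) (d : V -> R) (x : E -> R).
Hypothesis EsE1 : Es \subset E1.
Hypothesis FEs : F \subset Es.
Hypothesis dx : thin_flow_solution E1 Es d x.
Hypothesis d0 : forall v, 0 < d v.

Let x0 e : 0 <= x e. Proof. by have [[]] := dx. Qed.

Let ratio v := d v / lam v.

Let ratio0 v : 0 < ratio v. Proof. by rewrite divr_gt0. Qed.

Let dE v : d v = ratio v * lam v. Proof. by rewrite divfK// gt_eqF. Qed.

Lemma thin_flow_support e : 0 < x e -> e \in E1.
Proof.
have [_ x2 _ _ _] := dx.
by move=> xe; apply: contrapT => /negP /x2 xe0; rewrite xe0 ltxx in xe.
Qed.

Lemma thin_flow_le e : 0 < x e -> x e <= nu e * d (hd e).
Proof.
move=> xe; have [_ _ _ _ x5] := dx; have n0 := capacity_gt0 e.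
rewrite -ler_pdivrMl// mulrC x5 ?thin_flow_support// /rho.
by case: ifP => // _; rewrite le_max lexx orbT.
Qed.

(** Arcs whose flow is forced to be [nu e * d (hd e)]: those of [Es], and active ones on which a
    queue is about to form. *)
Definition saturated e := (e \in Es) || (e \in E1) && (d (tl e) < d (hd e)).

Lemma thin_flow_saturated e : saturated e -> x e = nu e * d (hd e).
Proof.
move=> se; have [_ _ _ x4 x5] := dx; have n0 := capacity_gt0 e.
have eE1 : e \in E1 by case/orP: se => [/(fintype.subsetP EsE1)//|/andP[]].
have le : d (hd e) <= x e / nu e.
  have := x4 _ eE1; move: se; rewrite /saturated /rho; case: ifP => //= _.
  by move=> /andP[_ lt]; rewrite le_max leNgt lt.
have xe : 0 < x e.
  by have := lt_le_trans (d0 _) le; rewrite pmulr_lgt0// invr_gt0.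
by apply/le_anti; rewrite thin_flow_le// mulrC -ler_pdivlMr.
Qed.

Lemma thin_flow_unsaturated e : ~~ saturated e -> 0 < x e -> d (hd e) = d (tl e).
Proof.
rewrite negb_or => /andP[eEs]; move=> + xe; have eE1 := thin_flow_support xe.
have [_ _ _ _ x5] := dx.
rewrite eE1 /= -leNgt => le; apply/le_anti; rewrite le /=.
by rewrite (x5 e eE1 xe) /rho (negPf eEs) le_max lexx.
Qed.

Let arc_gain e := x e * (ln (ratio (hd e)) - ln (ratio (tl e))) -
  arc_slope E1 Es d e.

Let arc_gainP e : 0 <= arc_gain e /\ (arc_gain e = 0 ->
  [/\ 0 < x e -> ratio (hd e) = ratio (tl e),
      saturated e -> ratio (hd e) = ratio (tl e) /\
        (e \notin F -> lam (tl e) <= lam (hd e)) &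
      e \notin F -> lam (tl e) < lam (hd e) -> saturated e]).
Proof.
have n0 := capacity_gt0 e.
rewrite /arc_gain /arc_slope; case: ifPn => eF.
  have se : saturated e by rewrite /saturated (fintype.subsetP FEs).
  rewrite -/(ratio (hd e)) -/(ratio (tl e)) (thin_flow_saturated se) dE.
  have [H1 H2] := free_arc n0 (lam0 (hd e)) (ratio0 (tl e)) (ratio0 (hd e)).
  by split=> // /H2.
have [se|se] := boolP (saturated e).
  rewrite (_ : (if e \in Es then _ else _) = d (hd e) - d (tl e)); last first.
    move: se; rewrite /saturated; case: ifP => // _ /= /andP[-> lt].
    by rewrite max_r// subr_ge0 ltW.
  rewrite (thin_flow_saturated se) (dE (hd e)) (dE (tl e)).
  have [H1 H2] := saturated_arc n0 (lam0 (tl e)) (lam0 (hd e)) (ratio0 (tl e))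
    (ratio0 (hd e)).
  by split=> // /H2[-> le]; split.
rewrite (_ : (if e \in Es then _ else _) = 0); last first.
  move: se; rewrite negb_or => /andP[/negPf ->].
  by case: ifP => //= _; rewrite -leNgt => le; rewrite max_l// subr_le0.
have xP : 0 < x e -> ratio (hd e) * lam (hd e) = ratio (tl e) * lam (tl e) /\
    x e <= nu e * (ratio (hd e) * lam (hd e)).
  by move=> xe; rewrite -!dE thin_flow_le// (thin_flow_unsaturated se).
rewrite (dE (tl e)).
have [H1 H2] := unsaturated_arc n0 (lam0 (tl e)) (lam0 (hd e)) (ratio0 (tl e))
  (ratio0 (hd e)) (x0 e) xP.
by split=> // /H2[le xr]; split=> // _; rewrite ltNge le.
Qed.

(* The identity for the flow x with node potentials ln (d v / lam v) turns the
   slope into a sum of nonnegative relative entropies. *)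
Let slopeE : potential_slope E1 Es d =
  inflow G * (ratio (sink G) - 1 - ln (ratio (sink G))) + \sum_e arc_gain e.
Proof.
have [fx _ x3 _ _] := dx.
rewrite sumrB (flow_potential_difference (fun v => ln (ratio v)) fx).
rewrite /potential_slope /ratio x3 lam_source invr1 mulr1 ln1; ring.
Qed.

Let sink_gain_ge0 : 0 <= ratio (sink G) - 1 - ln (ratio (sink G)).
Proof.
have [->|/ln_lt_subr1 ] := eqVneq (ratio (sink G)) 1.
  by rewrite ln1 !subrr.
by move=> /(_ (ratio0 _)); lra.
Qed.

Lemma potential_slope_ge0 : 0 <= potential_slope E1 Es d.
Proof.
rewrite slopeE addr_ge0//; first by rewrite mulr_ge0// ltW// inflow_gt0.
by apply: sumr_ge0 => e _; have [] := arc_gainP e.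
Qed.

Lemma potential_slope_eq0 : potential_slope E1 Es d = 0 ->
  d (sink G) / lam (sink G) = 1 /\ forall e,
  [/\ 0 < x e -> d (hd e) / lam (hd e) = d (tl e) / lam (tl e),
      saturated e -> d (hd e) / lam (hd e) = d (tl e) / lam (tl e) /\
        (e \notin F -> lam (tl e) <= lam (hd e)) &
      e \notin F -> lam (tl e) < lam (hd e) -> saturated e].
Proof.
have u0 := inflow_gt0 G.
have gain0 e : 0 <= arc_gain e by have [] := arc_gainP e.
rewrite slopeE => /eqP; rewrite paddr_eq0 ?sumr_ge0//; last first.
  by rewrite mulr_ge0// ltW.
rewrite mulf_eq0 gt_eqF//= => /andP[rt /eqP/psumr_eq0P gain]; split=> [|e].
  apply/eqP; apply: contraTT rt => /(ln_lt_subr1 (ratio0 _)) H.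
  by rewrite gt_eqF// subr_gt0.
by have [_] := arc_gainP e; apply; apply: gain.
Qed.

End Direction.

(** Otherwise the complement of [Q] could be lifted: arcs entering it carry no flow, and by closure
    under level arcs [lam] drops strictly along them. *)
Lemma maximal_level_connected (E1 Es : {set E}) x (Q : {set V}) :
  maximal_thin_flow_solution E1 Es lam x -> source G \in Q ->
  (forall e, 0 < x e -> hd e \in Q /\ tl e \in Q) ->
  (forall e, e \in E1 -> e \notin Es -> lam (hd e) = lam (tl e) -> x e = 0 ->
    tl e \in Q -> hd e \in Q) ->
  forall v, v \in Q.
Proof.
move=> [lamx lmax] sQ xQ Qcl v; have [[x0 _ _ _] _ _ x4 _] := lamx.
have x00 e : ~ 0 < x e -> x e = 0.
  by move=> /negP; rewrite -leNgt => xe; apply/le_anti; rewrite xe x0.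
have := maximal_not_raisable (S := ~: Q) lamx lmax.
move=> H; have /(_ v) : forall v, v \notin ~: Q; last by rewrite finset.inE negbK.
apply: H; first by rewrite finset.inE negbK.
  move=> e eE1; rewrite finset.inE => eQ.
  have xe : x e = 0 by apply: x00 => /xQ[hQ _]; rewrite hQ in eQ.
  have eEs : e \notin Es.
    apply/negP => eEs; have := x4 _ eE1; rewrite /rho eEs xe mul0r leNgt.
    by rewrite lam0.
  have le : lam (hd e) <= lam (tl e).
    by have := x4 _ eE1; rewrite /rho (negPf eEs) xe mul0r max_l// ltW.
  split=> //; rewrite finset.inE negbK => tQ; rewrite lt_neqAle le andbT.
  by apply: contra eQ => /eqP lameq; exact: Qcl.
move=> e _; rewrite finset.inE => tQ; apply: x00 => /xQ[_ tQ'].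
by rewrite tQ' in tQ.
Qed.

(** * Directions of zero slope *)

Section CriticalDirection.

Variables (l d : V -> R) (x : E -> R).
Hypothesis fl : feasible_labeling l.
Hypothesis dx : maximal_thin_flow_solution (active_arcs l) (queueing_arcs l) d x.

Let EsE1 : queueing_arcs l \subset active_arcs l.
Proof. by have [] := fl. Qed.

Let FEs : F \subset queueing_arcs l.
Proof. by apply/fintype.subsetP => e eF; rewrite mem_queueing eF. Qed.

Let d0 v : 0 < d v.
Proof. by apply: (thin_flow_direction_gt0 fl); exists x. Qed.

Let dx' : thin_flow_solution (active_arcs l) (queueing_arcs l) d x.
Proof. by have [] := dx. Qed.

Let slope := potential_slope (active_arcs l) (queueing_arcs l) d.

Lemma direction_slope_ge0 : 0 <= slope.
Proof. exact: potential_slope_ge0 EsE1 FEs dx' d0. Qed.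

Hypothesis crit : slope = 0.

Let sat := saturated (active_arcs l) (queueing_arcs l) d.

Let slope0 := potential_slope_eq0 EsE1 FEs dx' d0 crit.

Let ratio_source : d (source G) / lam (source G) = 1.
Proof. by have [_ _ -> _ _] := dx'; rewrite lam_source divff. Qed.

Lemma critical_flow_eq y : static_flow (inflow G) y ->
  (forall e, 0 < y e -> e \in active_arcs l /\
     d (hd e) / lam (hd e) = d (tl e) / lam (tl e)) ->
  forall e, 0 < y e -> d (hd e) = lam (hd e) /\ d (tl e) = lam (tl e).
Proof.
have [rt _] := slope0; move=> fy yr e ye.
have re : d (hd e) / lam (hd e) = 1.
  exact: (flow_ratio_eq1 (r := fun v => d v / lam v) fl fy ratio_source rt yr).
have ratio1 v : d v / lam v = 1 -> d v = lam v.
  by move=> H; rewrite -[LHS](divfK (lt0r_neq0 (lam0 v))) H mul1r.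
by split; apply: ratio1 => //; rewrite -(yr e ye).2.
Qed.

Lemma critical_flow e : 0 < x e -> d (hd e) = lam (hd e) /\ d (tl e) = lam (tl e).
Proof.
have [_ slope0'] := slope0; have [fx _ _ _ _] := dx'.
move=> xe; apply: (critical_flow_eq fx) xe => a xa.
split; first exact: (thin_flow_support dx' xa).
by have [/(_ xa)] := slope0' a.
Qed.

Let satx e : sat e -> 0 < x e.
Proof.
by move/(thin_flow_saturated EsE1 dx' d0) ->; rewrite mulr_gt0// capacity_gt0.
Qed.

Let satx_eq e : sat e -> x e = nu e * lam (hd e).
Proof.
move=> se; have [<- _] := critical_flow (satx se).
exact: thin_flow_saturated EsE1 dx' d0 _ se.
Qed.

Let queueing_sat e : e \in queueing_arcs l -> sat e.
Proof. by rewrite /sat /saturated => ->. Qed.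

(** Since [d = lam] at both ends of every arc carrying [x], the equations for [d] become equations
    for [lam]; the equality cases of the arc inequalities handle queueing arcs outside [F] and arcs
    without flow. *)
Lemma critical_steady : thin_flow_solution [set: E] F lam x.
Proof.
have [_ slope0'] := slope0; have [fx x2 x3 x4 x5] := dx'.
have x0 e : 0 <= x e by case: fx.
have eq e : 0 < x e -> lam (hd e) = rho F e (lam (tl e)) (x e).
  move=> xe; have eE1 := thin_flow_support dx' xe.
  have := x5 e eE1 xe; have [-> ->] := critical_flow xe.
  rewrite /rho; have [eF|eF] := boolP (e \in F).
    by rewrite mem_queueing eF.
  case: ifPn => // eEs H; rewrite max_r// -H.
  by have [_ /(_ (queueing_sat eEs))[_ /(_ eF)]] := slope0' e.
split=> // [e|e _|e _]; first by rewrite finset.in_setT.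
  have := x0 e; rewrite le_eqVlt => /predU1P[xe|/eq <-//].
  have nse : ~ sat e by move/satx; rewrite -xe ltxx.
  have eF : e \notin F.
    by apply/negP => eF; apply/nse/queueing_sat; rewrite mem_queueing eF.
  rewrite /rho (negPf eF) le_max leNgt; apply/orP; left; apply/negP => lt.
  by apply: nse; have [_ _] := slope0' e; apply.
exact: eq.
Qed.

Lemma critical_complementary : complementary x l.
Proof.
move=> e eF; split=> [xe|].
  by have := thin_flow_support dx' xe; rewrite mem_active (negPf eF).
apply: contraTT; rewrite -leNgt -ltNge => q0.
by rewrite satx_eq// queueing_sat// mem_queueing q0 orbT.
Qed.

(** The nodes with [d v < lam v] could be lifted: arcs into this set are unsaturated, so neither [d]
    nor [lam] increases along them, and a tail outside has [d (tl e) >= lam (tl e) > d (hd e)]. *)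
Lemma critical_ge v : lam v <= d v.
Proof.
have [_ slope0'] := slope0; have [fx _ x3 _ _] := dx'.
have x0 e : ~ 0 < x e -> x e = 0.
  have [fx0 _ _ _] := fx.
  by move=> /negP; rewrite -leNgt => xe; apply/le_anti; rewrite xe fx0.
have [_ dmax] := dx; pose S := finset.finset (fun v => d v < lam v).
have : v \notin S; last by rewrite inE -leNgt.
apply: (maximal_not_raisable dx' dmax); first by rewrite inE x3 lam_source ltxx.
  move=> e eE1; rewrite inE => eS.
  have xe : x e = 0 by apply: x0 => /critical_flow[H _]; rewrite H ltxx in eS.
  have nse : ~ sat e by move/satx; rewrite xe ltxx.
  have eEs : e \notin queueing_arcs l by apply/negP => /queueing_sat.
  have le : d (hd e) <= d (tl e).
    by rewrite leNgt; apply/negP => lt; apply: nse; rewrite /sat /saturated eE1 lt orbT.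
  split=> //; rewrite inE -leNgt; apply: lt_le_trans; apply: lt_le_trans eS _.
  have eF : e \notin F by apply: contra eEs => eF; rewrite mem_queueing eF.
  rewrite leNgt; apply/negP => lt; apply: nse.
  by have [_ _] := slope0' e; apply.
by move=> e _; rewrite inE => eS; apply: x0 => /critical_flow[_ H]; rewrite H ltxx in eS.
Qed.

(** Here [y] may differ from the flow of [d]; later it comes from an earlier moment. Queueing or
    growing arcs are saturated. If [d] is constant along an arc carrying [y], then [lam] cannot drop
    there, and a rise of [lam] again means saturation. *)
Lemma critical_anchor y : thin_flow_solution [set: E] F lam y -> complementary y l ->
  (forall e, 0 < y e -> e \notin queueing_arcs l -> d (tl e) <= d (hd e)) ->
  forall e, 0 < y e -> d (hd e) = lam (hd e) /\ d (tl e) = lam (tl e).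
Proof.
move=> ylam yl yd; have [fy _ _ _ _] := ylam; have [_ slope0'] := slope0.
move=> a ya; apply: (critical_flow_eq fy) ya => e ye {a}.
have eE1 : e \in active_arcs l.
  by rewrite mem_active; have [//|eF] := boolP (e \in F); have [/(_ ye)] := yl e eF.
split=> //; have [_ sate lt_sat] := slope0' e.
have {}sate : sat e -> d (hd e) / lam (hd e) = d (tl e) / lam (tl e) by case/sate.
have [eEs|eEs] := boolP (e \in queueing_arcs l); first exact/sate/queueing_sat.
have eF : e \notin F by apply: contra eEs => eF; rewrite mem_queueing eF.
have := yd e ye eEs; rewrite le_eqVlt => /predU1P[deq|dlt]; last first.
  by apply: sate; rewrite /sat /saturated eE1 dlt orbT.
have [lt|lt|leq] := ltgtP (lam (hd e)) (lam (tl e)).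
- by move: ye; rewrite (steady_flow_decreasing ylam eF lt) ltxx.
- exact/sate/lt_sat.
- by rewrite deq leq.
Qed.

End CriticalDirection.

End Potential.

(** * Trajectories *)

Section Trajectories.

Variables (R : realType) (G : generalized_network R).
Local Notation V := (vertex G).
Local Notation E := (edge G).
Local Notation tl := (@edge_tail R G).
Local Notation hd := (@edge_head R G).
Local Notation F := (free_arcs G).

Variable lam : V -> R.
Hypothesis lam0 : forall v, 0 < lam v.
Hypothesis lam_source : lam (source G) = 1.

Lemma finitely_many_directions : exists D : {set E} * {set E} -> V -> R,
  forall (E1 Es : {set E}) d, is_thin_flow_direction E1 Es d -> d = D (E1, Es).
Proof.
have /choice[D DP] (c : {set E} * {set E}) : exists d, forall d',
    is_thin_flow_direction c.1 c.2 d' -> d' = d.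
  have [[d cd]|nd] := pselect (exists d, is_thin_flow_direction c.1 c.2 d).
    by exists d => d' cd'; exact: thin_flow_direction_unique cd' cd.
  (* [lam] is an arbitrary default for pairs without a direction. *)
  by exists lam => d' cd'; exfalso; apply: nd; exists d'.
by exists D => E1 Es d /(DP (E1, Es)).
Qed.

(** Makes the time bounds independent of the trajectory. *)
Lemma direction_gap (f : {set E} -> {set E} -> (V -> R) -> R) :
  exists2 e, 0 < e & forall E1 Es d, is_thin_flow_direction E1 Es d ->
    0 < f E1 Es d -> e <= f E1 Es d.
Proof.
have [D DP] := finitely_many_directions.
have [e e0 eP] := finite_positive_gap (fun c => f c.1 c.2 (D c)).
exists e => // E1 Es d /DP -> H; exact: (eP (E1, Es)).
Qed.

Lemma direction_bound : exists2 M, 0 <= M &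
  forall (E1 Es : {set E}) d, is_thin_flow_direction E1 Es d -> forall v, d v <= M.
Proof.
have [D DP] := finitely_many_directions.
exists (\sum_(c : {set E} * {set E}) \sum_v `|D c v|).
  by apply: sumr_ge0 => c _; apply: sumr_ge0.
move=> E1 Es d /DP -> v; apply: le_trans (ler_norm _) _.
rewrite (bigD1 (E1, Es))//= (bigD1 v)//= -addrA lerDl addr_ge0//.
  exact: sumr_ge0.
by apply: sumr_ge0 => c _; apply: sumr_ge0.
Qed.

Section Trajectory.

Variable l : R -> V -> R.
Hypothesis lt : equilibrium_trajectory l.

Definition direction_of_motion theta d := [/\ feasible_labeling (l theta),
  is_direction_at (l theta) d &
  forall v, right_derivative (fun xi => l xi v) theta (d v)].

Let lac a b v : 0 <= a -> a <= b -> absolutely_continuous a b (fun xi => l xi v).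
Proof. by move=> *; have [H _ _] := lt; exact: H. Qed.

(** The only use of the almost everywhere clause of a trajectory. Read contrapositively, it also
    produces moments with prescribed directions. *)
Lemma trajectory_growth (g : R -> R) (c a b : R) : 0 <= a -> a <= b ->
  absolutely_continuous a b g ->
  (forall theta d, a <= theta -> theta < b -> direction_of_motion theta d ->
    exists2 D, right_derivative g theta D & c <= D) ->
  c * (b - a) <= g b - g a.
Proof.
move=> a0 ab gac gP; have [_ fl lae] := lt; apply: ac_growth => //.
move: lae; apply: lebesgue_ae_imp => theta H atheta thetab.
have [//|d dl dir] := H; first exact: le_trans atheta.
apply: (gP _ d) => //; split=> //; first by apply: fl; exact: le_trans atheta.
by move=> v; exact: is_derive_right.
Qed.

Lemma label_growth c a b v : 0 <= a -> a <= b ->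
  (forall theta d, a <= theta -> theta < b -> direction_of_motion theta d -> c <= d v) ->
  c * (b - a) <= l b v - l a v.
Proof.
move=> a0 ab H; apply: trajectory_growth (lac v a0 ab) _ => // theta d at_ tb dir.
by exists (d v); [have [_ _] := dir; apply|exact: H dir].
Qed.

Lemma label_growth_le c a b v : 0 <= a -> a <= b ->
  (forall theta d, a <= theta -> theta < b -> direction_of_motion theta d -> d v <= c) ->
  l b v - l a v <= c * (b - a).
Proof.
move=> a0 ab H.
have := @trajectory_growth (fun xi => -1 * l xi v) (- c) a b a0 ab
  (acZ _ (lac v a0 ab)).
rewrite !mulN1r mulNr -opprD lerN2; apply=> // theta d at_ tb dir.
exists (-1 * d v); last by rewrite mulN1r lerN2; exact: H dir.
by have [_ _ ld] := dir; exact: right_derivativeZ.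
Qed.

Let slope theta d :=
  potential_slope lam (active_arcs (l theta)) (queueing_arcs (l theta)) d.

Lemma motion_slope_ge0 theta d : direction_of_motion theta d -> 0 <= slope theta d.
Proof.
by move=> [fl [x dx] _]; exact: (direction_slope_ge0 lam0 lam_source fl dx).
Qed.

Lemma potential_growth c a b : 0 <= a -> a <= b ->
  (forall theta d, a <= theta -> theta < b -> direction_of_motion theta d ->
    c <= slope theta d) ->
  c * (b - a) <= potential lam (l b) - potential lam (l a).
Proof.
move=> a0 ab H.
apply: (trajectory_growth (g := fun xi => potential lam (l xi))) => //.
  by apply: ac_potential => v; exact: lac.
move=> theta d at_ tb dir; exists (slope theta d); last exact: H dir.
by have [_ _ ld] := dir; exact: right_derivative_potential.
Qed.

Lemma potential_nondecreasing a b : 0 <= a -> a <= b ->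
  potential lam (l a) <= potential lam (l b).
Proof.
move=> a0 ab; rewrite -subr_ge0 -(mul0r (b - a)).
by apply: potential_growth => // theta d _ _; exact: motion_slope_ge0.
Qed.

(** * Trajectories after a moment of zero slope *)

Section Critical.

Variables (theta0 : R) (d0 : V -> R) (y : E -> R).
Hypothesis theta0_ge0 : 0 <= theta0.
Hypothesis feas0 : feasible_labeling (l theta0).
Hypothesis dir0 : maximal_thin_flow_solution
  (active_arcs (l theta0)) (queueing_arcs (l theta0)) d0 y.
Hypothesis crit0 : slope theta0 d0 = 0.

Let ylam : thin_flow_solution [set: E] F lam y.
Proof. exact: (critical_steady lam0 lam_source feas0 dir0 crit0). Qed.

(** The flow [y] is steady and complementary to [l theta0], so the potential already attains its
    upper bound there and cannot decrease. *)
Lemma potential_max theta : theta0 <= theta ->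
  potential lam (l theta) = dual_bound lam y.
Proof.
move=> t; apply/le_anti; rewrite (potential_le lam0 ylam)/=.
rewrite -((potential_eq lam0 ylam _).2
  (critical_complementary lam0 lam_source feas0 dir0 crit0)).
exact: potential_nondecreasing.
Qed.

Lemma eventually_complementary theta : theta0 <= theta ->
  complementary lam y (l theta).
Proof. by move=> /potential_max H; apply/(potential_eq lam0 ylam). Qed.

Lemma eventually_critical theta d : theta0 <= theta -> direction_of_motion theta d ->
  slope theta d = 0.
Proof.
move=> t [_ _ ld]; have := right_derivative_potential lam ld.
move/right_derivative_cst_eq0; apply => h h0; rewrite !potential_max//.
by rewrite (le_trans t)// lerDl ltW.
Qed.

Lemma eventually_direction_ge theta d v : theta0 <= theta ->
  direction_of_motion theta d -> lam v <= d v.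
Proof.
move=> t dir; have := eventually_critical t dir; have [fl [x dx] _] := dir.
by move=> crit; exact: (critical_ge lam0 lam_source fl dx crit).
Qed.

Lemma eventually_anchored theta d e : theta0 <= theta ->
  direction_of_motion theta d -> 0 < y e ->
  d (hd e) = lam (hd e) /\ d (tl e) = lam (tl e).
Proof.
move=> t dir; have := eventually_critical t dir; have [fl [x dx] ld] := dir.
move=> crit; apply: (critical_anchor lam0 lam_source fl dx crit ylam).
  exact: eventually_complementary.
move=> a ya; rewrite mem_queueing negb_or -leNgt => /andP[aF qa].
rewrite -subr_ge0.
(* The excess of [a] is at most 0 at [theta] and, by complementarity, at least 0 afterwards. *)
apply: (right_derivative_ge0 (right_derivative_excess ld a)) => h h0.
apply: (le_trans qa); have th : theta0 <= theta + h.
  by rewrite (le_trans t)// lerDl ltW.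
by have [/(_ ya)] := eventually_complementary th aF.
Qed.

Lemma steady_lower a b v : theta0 <= a -> a <= b ->
  lam v * (b - a) <= l b v - l a v.
Proof.
move=> ta ab; apply: label_growth => //; first exact: le_trans ta.
by move=> theta d at_ _; apply: eventually_direction_ge; exact: le_trans at_.
Qed.

Lemma anchored_upper a b v : theta0 <= a -> a <= b ->
  (forall theta d, theta0 <= theta -> direction_of_motion theta d -> d v = lam v) ->
  l b v - l a v <= lam v * (b - a).
Proof.
move=> ta ab H; apply: label_growth_le => //; first exact: le_trans ta.
by move=> theta d at_ _ dir; rewrite (H theta)//; exact: le_trans at_.
Qed.

Lemma source_upper a b : theta0 <= a -> a <= b ->
  l b (source G) - l a (source G) <= lam (source G) * (b - a).
Proof.
move=> ta ab; apply: anchored_upper => // theta d _ [_ [x [[_ _ -> _ _] _]] _].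
by rewrite lam_source.
Qed.

Lemma flow_upper a b e : theta0 <= a -> a <= b -> 0 < y e ->
  l b (hd e) - l a (hd e) <= lam (hd e) * (b - a) /\
  l b (tl e) - l a (tl e) <= lam (tl e) * (b - a).
Proof.
move=> ta ab ye; split; apply: anchored_upper => // theta d t dir;
  by have [] := eventually_anchored t dir ye.
Qed.

Lemma level_step theta e : theta0 <= theta -> e \notin F -> y e = 0 ->
  l theta (hd e) <= l theta (tl e) + transit e.
Proof.
move=> t eF ye; have [_] := eventually_complementary t eF.
rewrite ye mulr_gt0 ?capacity_gt0// => /(_ isT); rewrite /excess; lra.
Qed.

(* A node off the flow y is reached from one on it by arcs along which lam is
   constant and which never queue, so it cannot run away from that node. *)
Lemma label_upper (K : R) v theta : 0 <= K ->
  maximal_thin_flow_solution [set: E] F lam y ->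
  (forall w, l theta0 w <= K) -> theta0 <= theta ->
  l theta v - lam v * (theta - theta0) <= K + (\sum_(e : E) transit e) *+ #|V|.
Proof.
move=> K0 ymax lK t.
pose anchored w := (w == source G) ||
  [exists e, (0 < y e) && ((hd e == w) || (tl e == w))].
have anchK w : anchored w -> l theta w - lam w * (theta - theta0) <= K.
  rewrite lerBlDl => aw; apply: le_trans (_ : l theta0 w + lam w * (theta - theta0) <= _).
    rewrite -lerBlDl; case/orP: aw => [/eqP ->|]; first exact: source_upper.
    move=> /existsP[e /andP[ye /orP[]/eqP <-]];
      by have [] := flow_upper (lexx _) t ye.
  by rewrite addrC lerD2l.
pose level : rel V := fun v w => [exists e, [&& e \notin F, y e == 0,
  lam (hd e) == lam (tl e), tl e == v & hd e == w]].
have levelP u w : level u w ->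
    l theta w <= l theta u + \sum_(e : E) transit e /\ lam w = lam u.
  case/existsP => e /and5P[eF /eqP ye /eqP leq /eqP <- /eqP <-]; split=> //.
  apply: le_trans (level_step t eF ye) _; rewrite lerD2l (bigD1 e)//= lerDl.
  by apply: sumr_ge0 => a _; exact: transit_ge0.
pose Q := finset.finset (fun w => [exists a, anchored a && connect level a w]).
have anchQ w : anchored w -> w \in Q.
  by move=> aw; rewrite inE; apply/existsP; exists w; rewrite aw connect0.
have : v \in Q.
  apply: (maximal_level_connected lam0 ymax) => [|e ye|e _ eF leq ye].
  - by apply: anchQ; rewrite /anchored eqxx.
  - by split; apply: anchQ; apply/orP; right; apply/existsP; exists e;
      rewrite ye eqxx ?orbT.
  - rewrite !inE => /existsP[a /andP[aa ac]]; apply/existsP; exists a; rewrite aa.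
    apply: connect_trans ac (connect1 _); apply/existsP; exists e.
    by rewrite eF ye leq !eqxx.
rewrite inE => /existsP[a /andP[/anchK aK /connectP[p0 p0P vE]]].
(* A path without repeated nodes has at most [#|V|] arcs, each adding at most the total transit
   time. *)
rewrite {}vE; case/shortenP: p0P => p pP pu _.
have tr0 : 0 <= \sum_(e : E) transit e by apply: sumr_ge0 => e _; exact: transit_ge0.
have walk : forall p u, path level u p ->
    l theta (last u p) <= l theta u + (\sum_(e : E) transit e) *+ size p /\
    lam (last u p) = lam u.
  elim=> [|w q IH] u /=; first by rewrite mulr0n addr0.
  move=> /andP[/levelP[lw lamw] /IH[lq ->]]; split=> //.
  by rewrite mulrS; move: lw lq; set S := _ *+ size q; lra.
have [lp ->] := walk _ _ pP.
have : (\sum_(e : E) transit e) *+ size p <= (\sum_(e : E) transit e) *+ #|V|.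
  rewrite ler_wpMn2l//; have := max_card (mem (a :: p)); rewrite (card_uniqP pu).
  exact: leq_trans.
lra.
Qed.

(** With [d0 = lam], the vector [lam] is maximal for the configuration at [theta0], so all nodes are
    reached from the source and the flow by level arcs active then. Such arcs are tight at [theta0]
    and never queue later, so the upper bound passes from tail to head. *)
Lemma eventually_linear v theta : theta0 <= theta ->
  d0 = lam -> l theta v = l theta0 v + lam v * (theta - theta0).
Proof.
move=> t d0lam; apply/le_anti/andP; split; last first.
  by rewrite -lerBrDl; exact: steady_lower.
rewrite -lerBlDl; move: theta t.
pose Q := finset.finset (fun w => `[< forall theta, theta0 <= theta ->
  l theta w - l theta0 w <= lam w * (theta - theta0) >]).
have : v \in Q; last by rewrite inE => /asboolP.
move: dir0; rewrite d0lam => dir.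
apply: (maximal_level_connected lam0 dir) => [|e ye|e eA eq leq ye].
- by rewrite inE; apply/asboolP => theta; exact: source_upper.
- by rewrite !inE; split; apply/asboolP => theta t; have [] := flow_upper (lexx _) t ye.
- rewrite !inE => /asboolP tQ; apply/asboolP => theta t.
  move: eA eq; rewrite mem_active mem_queueing negb_or => + /andP[eF].
  rewrite (negPf eF) -leNgt /= /excess => q1 q2.
  rewrite leq; apply: le_trans (tQ _ t); have := level_step t eF ye; lra.
Qed.

End Critical.

End Trajectory.

End Trajectories.

(** * The uniform time bound *)

Theorem theorem3p3 (R : realType) (G : generalized_network R)
    (lambda : vertex G -> R)
    (hlambda : is_thin_flow_direction [set: edge G] (free_arcs G) lambda)
    (l0 : vertex G -> R) (hl0 : feasible_labeling l0) :
  exists2 T : R, 0 <= T &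
    forall l : R -> vertex G -> R,
      equilibrium_trajectory l -> l 0 = l0 ->
      forall (v : vertex G) (theta : R), T <= theta ->
        is_derive theta (1 : R) (fun xi => l xi v) (lambda v).
Proof.
have lam0 := thin_flow_direction_gt0 (free_arcs_valid G) hlambda.
have [z [zlam lmax]] := hlambda.
have lam_source : lambda (source G) = 1 by have [_ _ ->] := zlam.
have [e1 e10 e1P] := direction_gap lambda (potential_slope lambda).
have [e2 e20 e2P] := direction_gap lambda
  (fun (_ _ : {set edge G}) d => \sum_v (d v - lambda v)).
have [M M0 MP] := direction_bound lambda.
set C := dual_bound lambda z.
have pC0 : potential lambda l0 <= C by exact: potential_le.
(* Growth at rate [e1] during [T0] would exceed the room [C - potential lambda l0] by [e1]. *)
pose T0 := (C - potential lambda l0) / e1 + 1.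
have T00 : 0 <= T0 by rewrite addr_ge0// divr_ge0 ?subr_ge0// ltW.
pose A := \sum_v `|l0 v|.
have A0 : 0 <= A by exact: sumr_ge0.
have l0A v : `|l0 v| <= A by rewrite /A (bigD1 v)//= lerDl sumr_ge0.
(* Labels grow at rate at most [M], so [K] bounds them up to time [T0]. *)
pose K := A + M * T0.
have K0 : 0 <= K by rewrite addr_ge0// mulr_ge0.
(* Summed bound of [label_upper] on the labels relative to steady motion, plus [A] because labels
   never fall below [l0]. *)
pose B := \sum_(v : vertex G) (K + (\sum_(e : edge G) transit e) *+ #|vertex G|) + A.
have B0 : 0 <= B.
  apply: addr_ge0 => //; apply: sumr_ge0 => v _; apply: addr_ge0 => //.
  by apply: mulrn_wge0; apply: sumr_ge0 => e _; exact: transit_ge0.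
pose L := B / e2 + 1.
have L0 : 0 <= L by rewrite addr_ge0// divr_ge0// ltW.
exists (T0 + L + 1); first exact: addr_ge0 (addr_ge0 T00 L0) ler01.
move=> l lt l00 v theta thetaT.
have [t0 [d0 [t00 t0T dir0 crit0]]] : exists t0 d0, [/\ 0 <= t0, t0 < T0,
    direction_of_motion l t0 d0 &
    potential_slope lambda (active_arcs (l t0)) (queueing_arcs (l t0)) d0 = 0].
  apply: contrapT => H.
  have : e1 * (T0 - 0) <= potential lambda (l T0) - potential lambda (l 0).
    apply: (potential_growth lt) => // t d t0 tT dir.
    have [_ dird _] := dir; apply: (e1P _ _ _ dird).
    rewrite lt_neqAle (motion_slope_ge0 lam0 lam_source dir) andbT eq_sym.
    by apply/eqP => s0; apply: H; exists t, d.
  have := potential_le lam0 zlam (l T0); rewrite -/C l00 subr0.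
  have -> : e1 * T0 = C - potential lambda l0 + e1 by rewrite /T0; field; rewrite gt_eqF.
  lra.
have [fl0 [y diry] _] := dir0.
have lK w : l t0 w <= K.
  have : l t0 w - l 0 w <= M * (t0 - 0).
    apply: (label_growth_le lt) => // t d _ _ [_ dird _]; exact: MP dird w.
  have := l0A w; have := ler_norm (l0 w); rewrite l00 subr0 /K.
  have := ler_wpM2l M0 (ltW t0T); lra.
have l0t0 w : l0 w <= l t0 w.
  rewrite -subr_ge0 -[leLHS](mul0r (t0 - 0)) -l00.
  apply: (label_growth lt) => // t d _ _ [fl dird _].
  exact/ltW/(thin_flow_direction_gt0 fl dird).
have ymax : maximal_thin_flow_solution [set: edge G] (free_arcs G) lambda y.
  by split=> //; exact: (critical_steady lam0 lam_source fl0 diry crit0).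
have [t1 [d1 [t01 t1L dir1 d1lam]]] : exists t1 d1, [/\ t0 <= t1, t1 < t0 + L,
    direction_of_motion l t1 d1 & d1 = lambda].
  apply: contrapT => H.
  (* Total deviation from steady motion: it would grow at rate at least [e2] as long as the
     direction is not [lambda]. *)
  pose g t := \sum_v (l t v - lambda v * (t - t0)).
  have t0L : t0 <= t0 + L by rewrite lerDl.
  have : e2 * (t0 + L - t0) <= g (t0 + L) - g t0.
    apply: (trajectory_growth lt) => //.
      apply: ac_sum => w; apply: acB; first by have [H' _ _] := lt; exact: H'.
      by apply/acZ/acB; [exact: ac_id|exact: ac_cst].
    move=> t d t0t tL dir; have [_ dird ld] := dir.
    exists (\sum_v (d v - lambda v)).
      apply: right_derivative_sum => w _; apply: right_derivativeB => //.
      have := right_derivativeZ (lambda w) (right_derivativeB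
        (right_derivative_id t) (right_derivative_cst t0 t)).
      by rewrite subr0 mulr1.
    have dge w : 0 <= d w - lambda w.
      rewrite subr_ge0.
      exact: (eventually_direction_ge lam0 lam_source lt t00 fl0 diry crit0 w t0t dir).
    have sge : 0 <= \sum_w (d w - lambda w) by apply: sumr_ge0 => w _; exact: dge.
    apply: (e2P _ _ _ dird); rewrite lt_neqAle sge andbT eq_sym; apply/eqP => s0.
    apply: H; exists t, d; split=> //; apply/funext => w; apply: subr0_eq.
    by apply: (psumr_eq0P _ s0) => // u _; exact: dge.
  have : g (t0 + L) - g t0 <= B.
    rewrite /g -sumrB /B /A -big_split /=; apply: ler_sum => w _.
    have := label_upper lam0 lam_source lt t00 fl0 diry crit0 w K0 ymax lK t0L.
    have := l0t0 w; have := ler_norm (- l0 w); rewrite normrN subrr mulr0 subr0.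
    by set S := _ *+ _; lra.
  have -> : e2 * (t0 + L - t0) = B + e2 by rewrite /L; field; rewrite gt_eqF.
  lra.
have t10 : 0 <= t1 by exact: le_trans t01.
have [fl1 [x dirx] _] := dir1.
have crit1 := eventually_critical lam0 lam_source lt t00 fl0 diry crit0 t01 dir1.
apply: (@is_derive_eventually_affine _ _ t1 (l t1 v)).
  by apply: lt_le_trans thetaT; lra.
by move=> xi; move/(eventually_linear lam0 lam_source lt t10 fl1 dirx crit1 v); apply.
Qed.
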